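(* Let $(W,S)$ be a finite Coxeter system and write $\bar x=w_Sxw_S$ for $x\in S$. Let $s,t\in S$ with $t\ne\bar s$, let $K=S\setminus\{s,\bar t\}$, let $u_\bullet$ be the rotation sequence associated to $(S,s,t)$ and $d=d(S,s,t)$. Then the relation $$[K+u_{-1}-u_1+u_0-u_2+u_1-u_3+\cdots-u_d+u_{d-1}-u_{d+1}]\ \leftrightharpoons\ [K+\bar u_{d+1}-\bar u_{d-1}+\bar u_d-\bar u_{d-2}+\bar u_{d-1}-\cdots-\bar u_0+\bar u_1-\bar u_{-1}]$$ holds, i.e. both sides express the same double coset (on the left the steps are $+u_{i-1}-u_{i+1}$ for $i=0,\dots,d$; on the right $+\bar u_{i+1}-\bar u_{i-1}$ for $i=d,\dots,0$). In terms of the generating relations of the singular Coxeter monoid, it is the composition of: a switchback relation from the left hand side to $[K+u_{-1}+u_0-u_d-u_{d+1}]$; the (commuting) up-up and down-down relations from the latter to $[K+u_0+u_{-1}-u_{d+1}-u_d]=[K+\bar u_{d+1}+\bar u_d-\bar u_0-\bar u_{-1}]$; and a switchback relation from the latter to the right hand side.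
   Context: For $I\subset S$, $W_I$ is the subgroup generated by $I$ and $w_I$ its longest element (all subsets are finitary since $W$ is finite). Write $Is=I\sqcup\{s\}$, $I\setminus s=I\setminus\{s\}$. For $I,J\subset S$, an $(I,J)$-coset is an element $p\in W_I\backslash W/W_J$ (the pair $(I,J)$ is part of the data), with Bruhat-maximal element $\overline p$. Let $*$ be the Coxeter monoid product on $W$ ($w*s=ws$ if $\ell(ws)>\ell(w)$, else $w*s=w$). For an $(I,J)$-coset $p$ and a $(J,L)$-coset $q$ set $p*q=W_I(\overline p*\overline q)W_L$ (composition in the singular Coxeter monoid); it is reduced if $\ell(\overline pw_J^{-1}\overline q)=\ell(\overline pw_J^{-1})+\ell(\overline q)$. An expression is a sequence $[I_0,\dots,I_m]$ of subsets in which consecutive subsets differ by adding or removing one element, also written $[I_0\pm s_1\pm\cdots\pm s_m]$ recording added ($+$)/removed ($-$) elements in order. It expresses $(W_{I_0}eW_{I_1})*\cdots*(W_{I_{m-1}}eW_{I_m})$; $\leftrightharpoons$ means both sides express the same coset. It is reduced if for each $1\le i\le m-1$ the composition of the coset expressed by $[I_0,\dots,I_i]$ with $W_{I_i}eW_{I_{i+1}}$ is reduced. Rotation sequence of $(S,s,t)$, for $s,t\in S$, $t\ne\bar s$: $u_0=s$, $u_{-1}=\bar t$, $u_{i+1}=w_{S\setminus u_i}u_{i-1}w_{S\setminus u_i}$ ($i\in\mathbb Z$). $d(S,s,t)$ is the maximal $k\ge0$ such that $[K+u_{-1}-u_1+u_0-u_2+\cdots+u_{k-1}-u_{k+1}]$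 (steps $+u_{i-1}-u_{i+1}$, $i=0,\dots,k$) is reduced, where $K=S\setminus\{s,\bar t\}$. Generating relations of the singular Coxeter monoid used here (applied to consecutive subexpressions): up-up $[I+x+y]\leftrightharpoons[I+y+x]$; down-down $[I-x-y]\leftrightharpoons[I-y-x]$; switchback, for $x,y\in S$ with $y\neq\bar x$: $[(S\setminus x)+x-y]\leftrightharpoons[(S\setminus x)-v_1+v_0-v_2+v_1-\cdots-v_e+v_{e-1}]$ where $v_\bullet$ is the rotation sequence of $(S,x,y)$ and $e=d(S,x,y)$. *)

(* Defs.v *)
From mathcomp Require Import all_boot all_order all_algebra all_fingroup.

Set Implicit Arguments.
Unset Strict Implicit.
Unset Printing Implicit Defensive.

Import GroupScope.

(* The group W is the whole type gT, and S is a set of elements of W. *)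
Section Coxeter.

Context {gT : finGroupType} (S : {set gT}).
Implicit Types (I J : {set gT}) (w x y s t : gT).

(* Congruence on words generated by (s t)^{m(s,t)} ~ 1, where m(s,t) is the
   order of s t in the group; for s = t the relator is s s. *)
Inductive coxeter_equiv : seq gT -> seq gT -> Prop :=
| CoxRefl a : coxeter_equiv a a
| CoxSym a b : coxeter_equiv a b -> coxeter_equiv b a
| CoxTrans a b c : coxeter_equiv a b -> coxeter_equiv b c -> coxeter_equiv a c
| CoxRel a b s t : s \in S -> t \in S ->
    coxeter_equiv (a ++ flatten (nseq #[s * t] [:: s; t]) ++ b) (a ++ b).

(* W = < S | (s t)^{m(s,t)} >. *)
Definition coxeter_system : Prop :=
  [/\ <<S>> = [set: gT],
      {in S, forall s, #[s] = 2}
    & forall a : seq gT, {subset a <= S} -> \prod_(x <- a) x = 1 ->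
        coxeter_equiv a [::]].

(* S ^+ n is the set of products of n elements of S; if S generates W, every
   element is such a product for some n < #|W|. *)
Definition len w : nat := find (fun n => w \in S ^+ n) (iota 0 #|gT|).

Definition longest I : gT := [arg max_(w > 1 in <<I>>) len w].

Definition bar x : gT := longest S * x * longest S.

Definition bruhat_step : rel gT := fun x y =>
  [exists r in class_support S [set: gT], (y == x * r) && (len x < len y)].

Definition bruhat : rel gT := connect bruhat_step.

Definition bruhat_max (p : {set gT}) : gT :=
  odflt 1 [pick x in p | [forall y in p, bruhat y x]].

Definition reduced_word y : seq gT :=
  if [pick e : (len y).-tuple gT |
        all [in S] e && (\prod_(x <- e) x == y)] is Some e
  then tval e else [::].

Definition star_gen w s : gT := if len w < len (w * s) then w * s else w.

Definition star x y : gT := foldl star_gen x (reduced_word y).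

(* An (I,J)-coset together with the pair (I,J). *)
Record dcoset := DCoset {
  dleft : {set gT};
  dright : {set gT};
  dset : {set gT}
}.

Definition coset_of_elt I w J : dcoset := DCoset I J (<<I>> * [set w] * <<J>>).

(* Meaningful when dright p = dleft q. *)
Definition dcomp (p q : dcoset) : dcoset :=
  coset_of_elt (dleft p)
    (star (bruhat_max (dset p)) (bruhat_max (dset q))) (dright q).

Definition dcomp_reduced (p q : dcoset) : Prop :=
  let pw := bruhat_max (dset p) * (longest (dright p))^-1 in
  let q' := bruhat_max (dset q) in
  len (pw * q') = len pw + len q'.

Definition adjacent : rel {set gT} := fun I J =>
  [exists x in S, (x \notin I) && (J == x |: I)
               || (x \in I) && (J == I :\ x)].

Definition is_expression (e : seq {set gT}) : bool :=
  [&& e != [::], all (fun I : {set gT} => I \subset S) e & sorted adjacent e].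

Fixpoint expressed_from (p : dcoset) I (e : seq {set gT}) : dcoset :=
  if e is J :: e' then expressed_from (dcomp p (coset_of_elt I 1 J)) J e'
  else p.

(* [I_0] expresses the identity (I_0,I_0)-coset; the value at the empty
   sequence, which is not an expression, is irrelevant. *)
Definition expressed (e : seq {set gT}) : dcoset :=
  match e with
  | [::] => coset_of_elt set0 1 set0
  | [:: I0] => coset_of_elt I0 1 I0
  | I0 :: I1 :: e' => expressed_from (coset_of_elt I0 1 I1) I1 e'
  end.

Definition same_coset (e f : seq {set gT}) : Prop :=
  [/\ is_expression e, is_expression f & expressed e = expressed f].

Definition reduced_expression (e : seq {set gT}) : Prop :=
  is_expression e /\
  forall i, 0 < i -> i.+1 < size e ->
    dcomp_reduced (expressed (take i.+1 e))
                  (coset_of_elt (nth set0 e i) 1 (nth set0 e i.+1)).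

Inductive step := Add of gT | Rem of gT.

Definition do_step I (a : step) : {set gT} :=
  match a with Add x => x |: I | Rem x => I :\ x end.

(* The sequence [I +- s_1 +- ... +- s_m]; if some added element is already
   present, or some removed one absent, the result is not an expression. *)
Definition expr I (a : seq step) : seq {set gT} := I :: scanl do_step I a.

Definition rot_next (p : gT * gT) : gT * gT :=
  (p.2, longest (S :\ p.2) * p.1 * longest (S :\ p.2)).

Definition rot_prev (p : gT * gT) : gT * gT :=
  ((longest (S :\ p.1))^-1 * p.2 * (longest (S :\ p.1))^-1, p.1).

(* The pairs are (u_(i-1), u_i), starting from (u_(-1), u_0); the recurrence is
   rotationE below. *)
Definition rotation s t (i : int) : gT :=
  match i with
  | Posz n => (iter n rot_next (bar t, s)).2
  | Negz n => (iter n rot_prev (bar t, s)).1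
  end.

(* [K + u_(-1) - u_1 + u_0 - u_2 + ... + u_(k-1) - u_(k+1)],
   with K = S \ {s, bar t}. *)
Definition rotation_expr s t (k : nat) : seq {set gT} :=
  let u := rotation s t in
  expr (S :\: [set s; bar t])
    (flatten [seq [:: Add (u (i%:Z - 1)%R); Rem (u (i%:Z + 1)%R)]
             | i <- iota 0 k.+1]).

(* d = d(S,s,t). *)
Definition rotation_depth s t (d : nat) : Prop :=
  reduced_expression (rotation_expr s t d) /\
  forall k, reduced_expression (rotation_expr s t k) -> k <= d.

Inductive up_up : seq {set gT} -> seq {set gT} -> Prop :=
| UpUp I x y : I \subset S -> x \in S -> y \in S ->
    x \notin I -> y \notin I -> x != y ->
    up_up (expr I [:: Add x; Add y]) (expr I [:: Add y; Add x]).

Inductive down_down : seq {set gT} -> seq {set gT} -> Prop :=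
| DownDown I x y : I \subset S -> x \in I -> y \in I -> x != y ->
    down_down (expr I [:: Rem x; Rem y]) (expr I [:: Rem y; Rem x]).

Inductive switchback : seq {set gT} -> seq {set gT} -> Prop :=
| Switchback x y e : x \in S -> y \in S -> y != bar x ->
    rotation_depth x y e ->
    switchback
      (expr (S :\ x) [:: Add x; Rem y])
      (expr (S :\ x)
        (flatten [seq [:: Rem (rotation x y (i%:Z)%R);
                          Add (rotation x y (i%:Z - 1)%R)]
                 | i <- iota 1 e])).

(* Application of a relation to a consecutive subexpression. *)
Definition locally (R : seq {set gT} -> seq {set gT} -> Prop)
    (e f : seq {set gT}) : Prop :=
  [/\ is_expression e, is_expression f
    & exists a b l r, [/\ R l r, e = a ++ l ++ b & f = a ++ r ++ b]].

Lemma rotationE s t (i : int) (u := rotation s t) :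
  u (i + 1)%R = longest (S :\ u i) * u (i - 1)%R * longest (S :\ u i).
Proof.
have up n : iter n rot_next (bar t, s) = (u (n%:Z - 1)%R, u (n%:Z)%R).
  elim: n => [|n IHn] //.
  have -> : (n.+1%:Z - 1)%R = (n%:Z)%R by rewrite -addn1 PoszD GRing.addrK.
  by rewrite [LHS]surjective_pairing {1}iterS /= IHn.
have down n : iter n rot_prev (bar t, s) = (u (Negz n), u (Negz n + 1)%R).
  elim: n => [|n IHn] //.
  have -> : (Negz n.+1 + 1)%R = Negz n by rewrite !NegzE -[n.+2]addn1 PoszD GRing.opprD GRing.subrK.
  by rewrite [LHS]surjective_pairing {2}iterS /= IHn.
case: i => n.
  have -> : (Posz n + 1)%R = Posz n.+1 by rewrite -addn1 PoszD.
  by rewrite {1}/u /rotation iterS up.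
have -> : (Negz n - 1)%R = Negz n.+1 by rewrite !NegzE -[n.+2]addn1 PoszD GRing.opprD.
have -> : u (Negz n.+1) = (rot_prev (u (Negz n), u (Negz n + 1)%R)).1.
  by rewrite -down.
by rewrite /= !mulgA mulgV mul1g mulgKV.
Qed.

End Coxeter.

(* Main.v *)
(* Write a_k and b_k for the longest elements of S \ {u_k} and S \ {u_(k-1), u_k}.
   The rotation expression is governed by x_k = (b_0 a_0) ... (b_(k-1) a_(k-1)) and
   z_k = x_k a_k = x_(k+1) b_(k+1) = b_0 x_(k+1): its first steps express the double
   coset with maximal element z_k, and it is reduced up to step d iff
   l(z_k) = l(x_k) + l(a_k) for k <= d.  If this fails at k + 1, then x_(k+1) has u_k
   as a right descent, hence so has z_k = b_0 x_(k+1), so z_k = w_S; conversely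
   z_k = w_S makes it fail.  Thus z_d = w_S at the depth d, and comparing descents and
   conjugation actions gives u_d = bar u_(-1) and u_(d+1) = bar u_0.  The right hand
   side is then the rotation expression of (S, bar t, bar s), whose rotation sequence
   is bar u_(d-k); its elements x'_k = z_(d-k) w_S and z'_k = x_(d-k) w_S show that
   its depth is d as well, so both switchback relations apply. *)

Require Import Defs.
From mathcomp Require Import all_boot all_order all_algebra all_fingroup.
From mathcomp Require Import zify.

Set Implicit Arguments.
Unset Strict Implicit.
Unset Printing Implicit Defensive.

Import GroupScope.

(** * Inversions of words *)

Section Inversions.

Context {gT : finGroupType}.
Implicit Types (a b : seq gT) (r s t x y : gT).

(* Parity of the number of positions of [a] whose deletion multiplies the product
   of [a] on the right by [r]. *)
Fixpoint inversion a r : bool :=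
  if a is s :: b then inversion b r (+) (r ^ (\prod_(x <- b) x)^-1 == s)
  else false.

Lemma inversion_cat a b r :
  inversion (a ++ b) r = inversion b r (+) inversion a (r ^ (\prod_(x <- b) x)^-1).
Proof.
elim: a => [|s a IHa] /=; first by rewrite addbF.
by rewrite IHa big_cat /= invMg conjgM addbA.
Qed.

Lemma prod_rcons a x : \prod_(y <- rcons a x) y = (\prod_(y <- a) y) * x.
Proof. by rewrite -cats1 big_cat /= big_cons big_nil mulg1. Qed.

Lemma prod_flatten_nseq n a :
  \prod_(x <- flatten (nseq n a)) x = (\prod_(x <- a) x) ^+ n.
Proof. by elim: n => [|n IHn]; rewrite /= ?big_nil // big_cat IHn expgS. Qed.

(* The reflections attached to the positions of the relator are [(t s)^i t] for
   [i < 2 m], each occurring for [i] and [i + m]. *)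
Lemma inversion_relator s t r : s * s = 1 -> t * t = 1 ->
  inversion (flatten (nseq #[s * t] [:: s; t])) r = false.
Proof.
move=> ss tt; have sV : s^-1 = s by apply/eqP; rewrite eq_invg_mul ss.
have tV : t^-1 = t by apply/eqP; rewrite eq_invg_mul tt.
pose g i := (t * s) ^+ i * t.
have gE n : t ^ ((s * t) ^+ n) = g n.*2 /\ (t * s * t) ^ ((s * t) ^+ n) = g n.*2.+1.
  have e : t * (s * t) ^+ n = (t * s) ^+ n * t.
    by elim: n => [|n IHn]; rewrite ?mulg1 ?mul1g // expgSr mulgA IHn expgSr !mulgA.
  have pV : (s * t) ^- n = (t * s) ^+ n by rewrite -expgVn invMg sV tV.
  split; rewrite conjgE pV /g -addnn.
    by rewrite e mulgA -expgD.
  by rewrite -!mulgA e !mulgA -(mulgA _ t s) -expgSr -expgD addSn.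
have inv_nseq n : inversion (flatten (nseq n [:: s; t])) r =
    \big[addb/false]_(0 <= i < n.*2) (r == g i).
  elim: n => [|n IHn]; first by rewrite big_nil.
  rewrite doubleS !big_nat_recr //= -IHn; have [<- <-] := gE n.
  have eqJ x y : (r ^ x^-1 == y) = (r == y ^ x).
    by rewrite -(inj_eq (conjg_inj x)) conjgKV.
  by rewrite big_cons prod_flatten_nseq !big_cons big_nil mulg1 !eqJ conjgM [s ^ t]conjgE tV mulgA.
have gD i : g (i + #[s * t]) = g i.
  have e : (t * s) ^+ #[s * t] = 1.
    by rewrite -[t * s]invgK invMg sV tV expgVn expg_order invg1.
  by rewrite /g expgD e mulg1.
move: gD (inv_nseq #[s * t]); set m := #[s * t] => gD ->.
rewrite -addnn (@big_cat_nat _ _ _ m) ?leq_addr //=.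
have -> : \big[addb/false]_(m <= i < m + m) (r == g i) =
    \big[addb/false]_(0 <= i < m) (r == g i).
  rewrite -{1}[m]add0n big_addn addnK.
  by apply: eq_bigr => i _; rewrite gD.
by rewrite addbb.
Qed.

(** The relator has product 1 and no inversions, so inserting it changes neither the conjugations
    applied to earlier letters nor the parity. *)
Lemma coxeter_equiv_inversion (S : {set gT}) a b :
    {in S, forall s, #[s] = 2} -> coxeter_equiv S a b ->
  inversion a =1 inversion b.
Proof.
move=> S2; elim=> // [{}a {}b _ ab r|{}a {}b c _ ab _ bc r|{}a {}b s t Ss St r].
- by rewrite ab.
- by rewrite ab bc.
have sq x : x \in S -> x * x = 1.
  by move=> /S2 o; rewrite -(expg_order x) o expgS expg1.
rewrite !inversion_cat inversion_relator ?sq // big_cat prod_flatten_nseq.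
by rewrite !big_cons big_nil mulg1 expg_order /= mul1g addbF.
Qed.

End Inversions.

(** * Length and strong exchange *)

Section Length.

Context {gT : finGroupType} (S : {set gT}) (hS : coxeter_system S).
Implicit Types (a b : seq gT) (r s t v w x y z : gT) (I J : {set gT}).
Local Notation len := (len S).

Lemma gen_S w : w \in <<S>>.
Proof. by case: hS => -> _ _; rewrite inE. Qed.

Lemma S_square s : s \in S -> s * s = 1.
Proof. by case: hS => _ S2 _ /S2 o; rewrite -(expg_order s) o expgS expg1. Qed.

Lemma S_inv s : s \in S -> s^-1 = s.
Proof. by move=> /S_square ss; apply/eqP; rewrite eq_invg_mul ss. Qed.

Lemma S_neq1 s : s \in S -> s != 1.
Proof. by case: hS => _ S2 _ /S2; apply: contra_eq_neq => ->; rewrite order1. Qed.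

Lemma mem_expg_set (A : {set gT}) n w :
  reflect (exists a, [/\ all [in A] a, size a = n & \prod_(x <- a) x = w])
          (w \in A ^+ n).
Proof.
apply: (iffP idP).
  elim: n w => [|n IHn] w; first by move/set1P->; exists [::]; rewrite big_nil.
  rewrite expgS => /mulsgP[x y Ax /IHn[a [Aa <- <-]] ->].
  by exists (x :: a); rewrite /= Ax Aa big_cons.
case=> a [Aa <- <-] {n w}; elim: a Aa => [|x a IHa] /=.
  by rewrite big_nil expg0 set11.
by case/andP=> Ax /IHa Aa; rewrite big_cons expgS mem_mulg.
Qed.

Lemma gen_word (A : {set gT}) w : w \in <<A>> ->
  exists2 a, all [in A] a & \prod_(x <- a) x = w.
Proof.
case/gen_prodgP=> n [c Ac ->]; exists [seq c i | i <- index_enum 'I_n].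
  by apply/allP=> _ /mapP[i _ ->]; apply: Ac.
by rewrite big_map.
Qed.

Lemma word_gen (A : {set gT}) a : all [in A] a -> \prod_(x <- a) x \in <<A>>.
Proof.
elim: a => [|x a IHa] /=; first by rewrite big_nil group1.
by case/andP=> Ax /IHa Aa; rewrite big_cons groupM // mem_gen.
Qed.

(** Two equal prefix products allow the letters between them to be cut out, so a word shrinks until
    its size is below [#|gT|]. This is why the bounded search in [len] succeeds. *)
Lemma short_word w : exists a, [/\ all [in S] a, size a < #|gT| & \prod_(x <- a) x = w].
Proof.
have [a0 Sa0 a0w] := gen_word (gen_S w).
have [n] := ubnP (size a0); elim: n a0 Sa0 a0w => // n IHn a Sa aw lt_an.
have [|le_a] := ltnP (size a) #|gT|; first by exists a.
pose p (i : 'I_(size a).+1) := \prod_(x <- take i a) x.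
have: ~~ injectiveb p.
  apply: contraL le_a => /injectiveP/leq_card.
  by rewrite card_ord -ltnNge.
case/injectivePn=> i [j]; wlog lt_ij: i j / i < j.
  move=> wl ij e; have [lt|lt|e'] := ltngtP i j; first exact: (wl i j).
    by apply: (wl j i) => //; rewrite eq_sym.
  by case/eqP: ij; apply: val_inj.
move=> _ e; apply: (IHn (take i a ++ drop j a)).
- rewrite all_cat; apply/andP; split; apply/allP=> x; [move/mem_take|move/mem_drop];
    exact: (allP Sa).
- by rewrite big_cat /= -[X in X * _]/(p i) e -big_cat cat_take_drop.
have := ltn_ord j; rewrite size_cat size_drop size_take_min; move: lt_an lt_ij.
rewrite !ltnS => lt_an lt_ij le_ja.
rewrite (minn_idPl (leq_trans (ltnW lt_ij) le_ja)).
by apply: leq_trans lt_an; rewrite -[X in _ < X](subnKC le_ja) ltn_add2r.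
Qed.

Lemma len_witness w : w \in S ^+ len w.
Proof.
have [a [Sa lt_a aw]] := short_word w.
have hw : has (fun n => w \in S ^+ n) (iota 0 #|gT|).
  apply/hasP; exists (size a); first by rewrite mem_iota.
  by apply/mem_expg_set; exists a.
by have:= nth_find 0 hw; rewrite nth_iota // -[X in _ < X](size_iota 0) -has_find.
Qed.

Lemma len_prod a : all [in S] a -> len (\prod_(x <- a) x) <= size a.
Proof.
move=> Sa; set w := \prod_(x <- a) x; rewrite leqNgt; apply/negP=> lt_a.
have lt_n : size a < #|gT|.
  by apply: leq_trans lt_a _; rewrite -[#|gT|](size_iota 0) find_size.
have := before_find 0 lt_a; rewrite nth_iota // add0n => /mem_expg_set[].
by exists a.
Qed.

Lemma len_word w : exists a, [/\ all [in S] a, size a = len w & \prod_(x <- a) x = w].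
Proof. exact/mem_expg_set/len_witness. Qed.

Lemma len1 : len 1 = 0.
Proof. by apply/eqP; rewrite -leqn0; have:= @len_prod [::] isT; rewrite big_nil. Qed.

Lemma len_eq0 w : (len w == 0) = (w == 1).
Proof.
apply/eqP/eqP=> [e|->]; last exact: len1.
by have [a [_ /eqP]] := len_word w; rewrite e => /nilP -> <-; rewrite big_nil.
Qed.

Lemma lenM x y : len (x * y) <= len x + len y.
Proof.
have [a [Sa <- ax]] := len_word x; have [b [Sb <- bx]] := len_word y.
by rewrite -ax -bx -big_cat -size_cat len_prod // all_cat Sa.
Qed.

Lemma prod_rev a : all [in S] a -> \prod_(x <- rev a) x = (\prod_(x <- a) x)^-1.
Proof.
elim: a => [|s a IHa] /=; first by rewrite !big_nil invg1.
case/andP=> Ss Sa; rewrite rev_cons -cats1 big_cat IHa //= !big_cons big_nil.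
by rewrite invMg mulg1 (S_inv Ss).
Qed.

Lemma lenV x : len x^-1 = len x.
Proof.
suff le y : len y^-1 <= len y by apply/eqP; rewrite eqn_leq le -{1}[x]invgK le.
have [a [Sa <- <-]] := len_word y.
by rewrite -prod_rev // -size_rev len_prod // all_rev.
Qed.

Lemma len_eq1 w : (len w == 1%N) = (w \in S).
Proof.
apply/eqP/idP=> [e|Sw].
  have [a [/allP Sa]] := len_word w; rewrite e; case: a Sa => [|s []] // Sa _ <-.
  by rewrite big_cons big_nil mulg1; apply: Sa; rewrite inE.
apply/eqP; rewrite eqn_leq lt0n len_eq0 S_neq1 // andbT.
by have:= @len_prod [:: w]; rewrite big_cons big_nil mulg1; apply; rewrite /= Sw.
Qed.

Lemma reduced_wordP y : [/\ all [in S] (reduced_word S y),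
  size (reduced_word S y) = len y & \prod_(x <- reduced_word S y) x = y].
Proof.
rewrite /reduced_word; case: pickP => [e /andP[Se /eqP ee]|no].
  by rewrite size_tuple.
have [b [Sb sb eb]] := len_word y.
by move/eqP: sb => sb; have:= no (Tuple sb); rewrite /= Sb eb eqxx.
Qed.

(** For a reflection [r] this amounts to [len (w * r) < len w] ([inverts_len]). Defined as a parity,
    it obeys the cocycle rule [invertsM], on which the length computations rest. *)
Definition inverts w r : bool := inversion (reduced_word S w) r.

(** Both [a ++ rev b] and [b ++ rev b] have product 1, hence no inversions by the presentation. So
    [a] and [b] share the parity of [rev b] at the same conjugate of [r]. *)
Lemma inversion_word_eq a b r : all [in S] a -> all [in S] b ->
  \prod_(x <- a) x = \prod_(x <- b) x -> inversion a r = inversion b r.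
Proof.
case: hS => _ S2 hR Sa Sb eab.
have E c : all [in S] c -> \prod_(x <- c) x = \prod_(x <- b) x ->
    forall q, inversion (rev b) q (+) inversion c (q ^ (\prod_(x <- rev b) x)^-1) = false.
  move=> Sc ec q; rewrite -inversion_cat.
  rewrite (@coxeter_equiv_inversion _ S _ [::]) //; apply: hR.
    by apply/allP; rewrite all_cat Sc all_rev.
  by rewrite big_cat /= ec prod_rev // mulgV.
move: (E a Sa eab (r ^ \prod_(x <- rev b) x)) (E b Sb erefl (r ^ \prod_(x <- rev b) x)).
by rewrite conjgK; do 3!case: (inversion _ _).
Qed.

Lemma inverts_word a r : all [in S] a -> inverts (\prod_(x <- a) x) r = inversion a r.
Proof.
move=> Sa; have [Sb _ eb] := reduced_wordP (\prod_(x <- a) x).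
exact: inversion_word_eq.
Qed.

Lemma invertsM x y r : inverts (x * y) r = inverts y r (+) inverts x (r ^ y^-1).
Proof.
have [a [Sa _ <-]] := len_word x; have [b [Sb _ <-]] := len_word y.
by rewrite -big_cat !inverts_word ?all_cat ?Sa // inversion_cat.
Qed.

Lemma inverts1 r : inverts 1 r = false.
Proof. by have:= @inverts_word [::] r isT; rewrite big_nil. Qed.

Lemma invertsS s r : s \in S -> inverts s r = (r == s).
Proof.
move=> Ss; have:= @inverts_word [:: s] r; rewrite /= Ss big_cons !big_nil mulg1.
by rewrite invg1 conjg1 => ->.
Qed.

Definition reflection r := r \in class_support S [set: gT].

Lemma reflectionP r : reflect (exists2 s, s \in S & exists x, r = s ^ x) (reflection r).
Proof.
apply: (iffP imset2P) => [[s x Ss _ ->]|[s Ss [x ->]]]; first by exists s => //; exists x.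
by exists s x; rewrite ?inE.
Qed.

Lemma reflectionS s : s \in S -> reflection s.
Proof. by move=> Ss; apply/reflectionP; exists s => //; exists 1; rewrite conjg1. Qed.

Lemma reflectionJ r x : reflection (r ^ x) = reflection r.
Proof.
have imp q y : reflection q -> reflection (q ^ y).
  case/reflectionP=> s Ss [z ->]; apply/reflectionP; exists s => //.
  by exists (z * y); rewrite conjgM.
by apply/idP/idP=> /imp H; [rewrite -(conjgK x r)|]; apply: H.
Qed.

Lemma reflection_square r : reflection r -> r * r = 1.
Proof. by case/reflectionP=> s Ss [x ->]; rewrite -conjMg S_square // conj1g. Qed.

(** Write [r] as [x^-1 * s * x]. By the cocycle rule the contributions of [x^-1] and [x] cancel,
    which leaves that of [s] at itself. *)
Lemma inverts_self r : reflection r -> inverts r r.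
Proof.
case/reflectionP=> s Ss [x ->]; have := inverts1 (s ^ x); rewrite -[1](mulVg x) invertsM.
rewrite conjgK [X in _ -> is_true (inverts X _)]conjgE !invertsM.
rewrite (invertsS _ Ss) invMg conjgM conjgK.
by rewrite (S_inv Ss) [s ^ s]conjgE (S_square Ss) mulg1 (S_inv Ss) eqxx;
  do 2!case: (inverts _ _).
Qed.

(** Strong exchange: an odd number of positions is nonzero, so one can be deleted. If the tail does
    not supply it, the head letter does. *)
Lemma inversion_delete a r : all [in S] a -> inversion a r ->
  exists b, [/\ subseq b a, size b < size a
              & \prod_(x <- b) x = (\prod_(x <- a) x) * r].
Proof.
elim: a => [|s a IHa] //= /andP[Ss Sa]; case iv: (inversion a r) => /=.
  move=> _; have [b [sb lt_b eb]] := IHa Sa iv.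
  by exists (s :: b); rewrite /= eqxx !big_cons eb mulgA.
move=> /eqP e; exists a; split=> //; first exact: subseq_cons.
rewrite big_cons -[r](conjgKV (\prod_(x <- a) x)) e conjgE -mulgA mulKVg mulgA.
by rewrite S_square ?mul1g.
Qed.

Lemma inverts_len_lt w r : inverts w r -> len (w * r) < len w.
Proof.
have [a [Sa <- <-]] := len_word w; rewrite inverts_word //.
case/(inversion_delete Sa) => b [/mem_subseq sb lt_b <-].
by apply: leq_ltn_trans lt_b; apply: len_prod; apply/allP=> x /sb/(allP Sa).
Qed.

(** The converse of [inverts_len_lt]: since [r] inverts itself, exactly one of [w] and [w * r]
    inverts [r], and that one is the longer. *)
Lemma inverts_len w r : reflection r -> inverts w r = (len (w * r) < len w).
Proof.
move=> Rr; case iv: (inverts w r); first by rewrite inverts_len_lt.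
have := @inverts_len_lt (w * r) r; rewrite invertsM inverts_self //.
rewrite conjgE invgK mulgV mulg1 iv => /(_ isT).
by rewrite -mulgA reflection_square // mulg1 => /ltnW; rewrite leqNgt => /negbTE.
Qed.

Lemma len_reflection_neq w r : reflection r -> len (w * r) != len w.
Proof.
move=> Rr; rewrite neq_ltn -inverts_len //; case iv: (inverts w r) => //=.
have := @inverts_len_lt (w * r) r; rewrite invertsM inverts_self //.
rewrite conjgE invgK mulgV mulg1 iv => /(_ isT).
by rewrite -mulgA reflection_square // mulg1.
Qed.

Lemma len_mulS w s : s \in S -> len (w * s) = if inverts w s then (len w).-1 else (len w).+1.
Proof.
move=> Ss; have Rs := reflectionS Ss.
have l1 : len (w * s) <= len w + 1.
  by apply: leq_trans (lenM _ _) _; move: (len_eq1 s); rewrite Ss => /eqP ->.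
have l2 : len w <= len (w * s) + 1.
  rewrite -{1}[w](mulgK s) (S_inv Ss); apply: leq_trans (lenM _ _) _.
  by move: (len_eq1 s); rewrite Ss => /eqP ->.
have := len_reflection_neq w Rs; rewrite inverts_len // neq_ltn.
by case: ltnP => /= *; lia.
Qed.

End Length.

(** * Parabolic subgroups and longest elements *)

Section Parabolic.

Context {gT : finGroupType} (S : {set gT}) (hS : coxeter_system S).
Implicit Types (a b : seq gT) (r s t v w x y z : gT) (I J : {set gT}).
Local Notation len := (len S).
Local Notation inverts := (inverts S).
Local Notation reflection := (reflection S).
Local Notation longest := (longest S).

Lemma inverts_lenS w s : s \in S -> inverts w s = (len (w * s) < len w).
Proof. by move=> Ss; rewrite (inverts_len hS) // reflectionS. Qed.

Lemma inverts_lenV w s : s \in S -> inverts w^-1 s = (len (s * w) < len w).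
Proof.
by move=> Ss; rewrite inverts_lenS // -{1}[s](S_inv hS) // -invMg !(lenV hS).
Qed.

(** Appending a letter of [J] either lengthens a reduced word or, by exchange, yields a subword,
    whose letters are still in [J]. *)
Lemma parab_word J w : J \subset S -> w \in <<J>> ->
  exists a, [/\ all [in J] a, size a = len w & \prod_(x <- a) x = w].
Proof.
move=> sJS /gen_word[a + <-]; elim/last_ind: a => [|a s IHa].
  by exists [::]; rewrite big_nil len1.
rewrite all_rcons => /andP[Js /IHa[b [Jb sb eb]]]; have Ss := subsetP sJS s Js.
have Sb : all [in S] b by apply: sub_all Jb => x; apply: (subsetP sJS).
rewrite prod_rcons (len_mulS hS _ Ss).
case: ifP => [iv|_]; last first.
  by exists (rcons b s); rewrite all_rcons Js size_rcons sb prod_rcons eb.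
have := iv; rewrite -eb (inverts_word hS) // => /(inversion_delete hS Sb)[c [sc lt_c ec]].
exists c; rewrite ec; split=> //; first by apply/allP => x /(mem_subseq sc)/(allP Jb).
have Sc : all [in S] c by apply/allP => x /(mem_subseq sc)/(allP Sb).
have := len_prod Sc; rewrite ec (len_mulS hS _ Ss) eb iv; lia.
Qed.

Lemma mem_genS J s : J \subset S -> s \in S -> (s \in <<J>>) = (s \in J).
Proof.
move=> sJS Ss; apply/idP/idP=> [/(parab_word sJS)[a [/allP Ja]]|/mem_gen//].
have /eqP -> : len s == 1%N by rewrite (len_eq1 hS).
by case: a Ja => [|x []] // Ja _ <-; rewrite big_cons big_nil mulg1 Ja ?mem_head.
Qed.

Lemma inverts_parab J w r : J \subset S -> w \in <<J>> -> inverts w r -> r \in <<J>>.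
Proof.
move=> sJS /(parab_word sJS)[a [Ja _ <-]].
have Sa : all [in S] a by apply: sub_all Ja => x; apply: (subsetP sJS).
rewrite (inverts_word hS) //; elim: a Ja {Sa} => [|s a IHa] //= /andP[Js Ja].
case iv: (inversion a r) => /= e; first exact: IHa.
by rewrite -(groupJr _ (groupVr (word_gen Ja))); move/eqP: e => ->; rewrite mem_gen.
Qed.

Lemma reduced_word_last a s : all [in S] (rcons a s) ->
    size (rcons a s) = len (\prod_(x <- rcons a s) x) ->
  [/\ size a = len (\prod_(x <- a) x), inverts (\prod_(x <- rcons a s) x) s
    & inverts (\prod_(x <- a) x) s = false].
Proof.
rewrite all_rcons => /andP[Ss Sa]; have := len_prod Sa.
rewrite size_rcons prod_rcons => le1 e.
have := lenM hS (\prod_(x <- a) x) s; rewrite -e.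
have /eqP -> : len s == 1%N by rewrite (len_eq1 hS).
rewrite !inverts_lenS // -mulgA (S_square hS) // mulg1 -e. split; lia.
Qed.

(** The last letter is an inverted reflection, hence lies in [<<J>>], and can be peeled off. This
    covers the arbitrary choice made by [reduced_word]. *)
Lemma parab_reduced_word J a : J \subset S -> all [in S] a ->
    size a = len (\prod_(x <- a) x) -> \prod_(x <- a) x \in <<J>> ->
  all [in J] a.
Proof.
move=> sJS; elim/last_ind: a => // a s IHa Sas /(reduced_word_last Sas)[sa ia _] Ja.
have Js := inverts_parab sJS Ja ia.
move: Sas Ja; rewrite !all_rcons prod_rcons.
case/andP=> Ss Sa; rewrite groupMr // => Jas; rewrite IHa // andbT.
by rewrite -mem_genS.
Qed.

(** By the cocycle rule, a new last letter [s] is a descent only through the preceding word, which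
    reducedness excludes, or through [x] inverting a conjugate of [s] in the subgroup. *)
Lemma len_mul_word x a : all [in S] a -> size a = len (\prod_(x <- a) x) ->
    (forall r, r \in <<[set s in a]>> -> reflection r -> ~~ inverts x r) ->
  len (x * \prod_(x <- a) x) = len x + size a.
Proof.
elim/last_ind: a => [|a s IHa] Sas; first by rewrite big_nil mulg1 addn0.
case/(reduced_word_last Sas) => sa _ ia xr.
have sub : [set s in a] \subset [set s0 in rcons a s].
  by apply/subsetP=> y; rewrite !inE mem_rcons inE => ->; rewrite orbT.
have ga : \prod_(x <- a) x \in <<[set s0 in rcons a s]>>.
  by apply: (subsetP (genS sub)); apply: word_gen; apply/allP=> y; rewrite inE.
have gs : s \in <<[set s0 in rcons a s]>> by rewrite mem_gen // inE mem_rcons mem_head.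
move: Sas; rewrite all_rcons prod_rcons => /andP[Ss Sa].
rewrite size_rcons addnS -IHa //; last by move=> r /(subsetP (genS sub)); apply: xr.
rewrite mulgA (len_mulS hS _ Ss) (invertsM hS) ia /= (negbTE (xr _ _ _)) //.
  by rewrite groupJr ?groupV.
by rewrite reflectionJ reflectionS.
Qed.

Lemma min_coset_rep J z : exists x y, [/\ z = x * y, y \in <<J>>
  & forall r, r \in <<J>> -> reflection r -> ~~ inverts x r].
Proof.
pose P x := x \in z *: <<J>>.
have Pz : P z by rewrite /P lcoset_refl.
case: (arg_minnP len Pz) => x Px min_x; exists x, (x^-1 * z); split.
- by rewrite mulKVg.
- by move: Px; rewrite /P mem_lcoset => /groupVr; rewrite invMg invgK.
move=> r Jr Rr; rewrite (inverts_len hS) // -leqNgt min_x //.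
by move: Px; rewrite /P !mem_lcoset mulgA => Px; rewrite groupM.
Qed.

Lemma len_min_mul J x y : J \subset S ->
    (forall r, r \in <<J>> -> reflection r -> ~~ inverts x r) ->
  y \in <<J>> -> len (x * y) = len x + len y.
Proof.
move=> sJS xr /(parab_word sJS)[a [Ja sa ea]]; rewrite -sa -ea len_mul_word //.
- by apply: sub_all Ja => s; apply: (subsetP sJS).
- by rewrite ea.
move=> r ra; apply: xr; apply: subsetP ra; apply: genS.
by apply/subsetP => s; rewrite inE; apply: (allP Ja).
Qed.

Lemma no_descent J y : J \subset S -> y \in <<J>> ->
  {in J, forall s, ~~ inverts y s} -> y = 1.
Proof.
move=> sJS /(parab_word sJS)[a [Ja + ea]]; rewrite -{y}ea.
case/lastP: a Ja => [|a s]; first by rewrite big_nil.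
move=> Jas sas yJ; have Sas : all [in S] (rcons a s).
  by apply: sub_all Jas => t; apply: (subsetP sJS).
have [_] := reduced_word_last Sas sas.
by rewrite (negbTE (yJ s _)) //; move: Jas; rewrite all_rcons => /andP[].
Qed.

(** Minimality can be tested on simple reflections: if the [<<J>>]-part of [x] were nontrivial, its
    last letter would be a descent of [x]. *)
Lemma len_right_min J x y : J \subset S -> {in J, forall s, ~~ inverts x s} ->
  y \in <<J>> -> len (x * y) = len x + len y.
Proof.
move=> sJS xJ; have [m [v [ex Jv mr]]] := min_coset_rep J x.
have v1 : v = 1.
  apply: (@no_descent J) => // s Js; have Ss := subsetP sJS s Js.
  have Jvs : v * s \in <<J>> by rewrite groupM // mem_gen.
  have := xJ s Js; rewrite ex !inverts_lenS // -mulgA !(len_min_mul sJS mr) //.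
  by rewrite ltn_add2l.
by move: ex; rewrite v1 mulg1 => ->; apply: len_min_mul.
Qed.

Lemma longest_in J : longest J \in <<J>>.
Proof. by rewrite /Defs.longest; case: arg_maxnP. Qed.

Lemma longest_max J y : y \in <<J>> -> len y <= len (longest J).
Proof. by rewrite /Defs.longest; case: arg_maxnP => // x _ mx /mx. Qed.

Lemma longest_inverts J y r : len (longest J) <= len y -> y \in <<J>> ->
  r \in <<J>> -> reflection r -> inverts y r.
Proof.
move=> le_y Jy Jr Rr; rewrite (inverts_len hS) // ltn_neqAle (len_reflection_neq hS) //=.
by apply: leq_trans le_y; rewrite longest_max ?groupM.
Qed.

(** The longest element inverts every reflection of [<<J>>], so by the cocycle rule each letter of a
    reduced word of [y] shortens the product. *)
Lemma len_longest_mul J y : J \subset S -> y \in <<J>> ->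
  len (longest J * y) + len y = len (longest J).
Proof.
move=> sJS /(parab_word sJS)[a [Ja + ea]]; rewrite -{y}ea; elim/last_ind: a Ja => [|a s IHa].
  by rewrite big_nil mulg1 len1 addn0.
move=> Jas sas; have Sas : all [in S] (rcons a s).
  by apply: sub_all Jas => t; apply: (subsetP sJS).
have [sa _ ia] := reduced_word_last Sas sas.
move: sas Jas; rewrite prod_rcons all_rcons size_rcons => <- /andP[Js Ja].
have Ss := subsetP sJS s Js.
have iv : inverts (longest J * \prod_(x <- a) x) s.
  rewrite (invertsM hS) ia (@longest_inverts J) ?longest_in //=.
    by apply: groupJ; rewrite ?groupV ?word_gen ?mem_gen.
  by rewrite reflectionJ reflectionS.
have := iv; rewrite inverts_lenS // => lt_s; have := IHa Ja sa; rewrite -sa mulgA.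
by move: lt_s; rewrite (len_mulS hS _ Ss) iv; lia.
Qed.

(** Left multiplication by the longest element complements lengths, so descents of [y] become
    ascents of [(longest J)^-1 * y], which is therefore trivial. *)
Lemma longest_unique J y : J \subset S -> y \in <<J>> ->
  {in J, forall s, inverts y s} -> y = longest J.
Proof.
move=> sJS Jy yJ; have wJ := longest_in J.
suff: (longest J)^-1 * y = 1 by move/(canRL (mulKg _)); rewrite mulg1 invgK.
apply: (@no_descent J) => // [|s Js]; first by rewrite groupM ?groupV.
have Ss := subsetP sJS s Js; set v := _ * y.
have Jv : v \in <<J>> by rewrite groupM ?groupV.
have e1 : len y + len v = len (longest J).
  by rewrite -(len_longest_mul sJS Jv) mulKVg.
have Jvs : v * s \in <<J>> by rewrite groupM // mem_gen.
have e2 : len (y * s) + len (v * s) = len (longest J).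
  by rewrite -(len_longest_mul sJS Jvs) mulgA mulKVg.
by have := yJ s Js; rewrite !inverts_lenS //; clearbody v; lia.
Qed.

Lemma longestV J : J \subset S -> (longest J)^-1 = longest J.
Proof.
move=> sJS; apply: longest_unique => // [|s Js]; first by rewrite groupV longest_in.
apply: (@longest_inverts J); rewrite ?(lenV hS) ?groupV ?longest_in ?mem_gen //.
by rewrite reflectionS // (subsetP sJS).
Qed.

Lemma longest_descent J s : J \subset S -> s \in J -> inverts (longest J) s.
Proof.
move=> sJS Js; rewrite (@longest_inverts J) ?longest_in ?mem_gen //.
by rewrite reflectionS // (subsetP sJS).
Qed.

Lemma right_max_split J z : J \subset S -> {in J, forall s, inverts z s} ->
  exists2 x, z = x * longest J & forall y, y \in <<J>> -> len (x * y) = len x + len y.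
Proof.
move=> sJS zJ; have [x [y [ez Jy xr]]] := min_coset_rep J z.
exists x; last by move=> v; apply: len_min_mul.
rewrite ez; congr (_ * _); apply: longest_unique => // s Js.
have Ss := subsetP sJS s Js.
have Jys : y * s \in <<J>> by rewrite groupM // mem_gen.
have := zJ s Js; rewrite ez !inverts_lenS // -mulgA !(len_min_mul sJS xr) //.
by rewrite ltn_add2l.
Qed.

Lemma len_right_max J z y : J \subset S -> {in J, forall s, inverts z s} ->
  y \in <<J>> -> len (z * y) + len y = len z.
Proof.
move=> sJS /(right_max_split sJS)[x -> xJ] Jy.
rewrite -mulgA !xJ ?groupM ?longest_in // -addnA.
by rewrite len_longest_mul.
Qed.

(** Both lengths are complementary to that of [y * longest J]. *)
Lemma longest_conj_len J y : J \subset S -> y \in <<J>> -> len (y ^ longest J) = len y.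
Proof.
move=> sJS Jy; rewrite conjgE longestV //.
have Jyw : y * longest J \in <<J>> by rewrite groupM ?longest_in.
have e : len (y * longest J) + len y = len (longest J).
  rewrite -(len_longest_mul sJS (groupVr Jy)) (lenV hS); congr (_ + _).
  by rewrite -[LHS](lenV hS) invMg longestV.
by have := len_longest_mul sJS Jyw; rewrite -e addnC => /addnI.
Qed.

Lemma conj_longest J : J \subset S -> J :^ longest J = J.
Proof.
move=> sJS; apply/eqP; rewrite eqEcard cardJg leqnn andbT.
apply/subsetP=> _ /imsetP[s Js ->].
have Jw : s ^ longest J \in <<J>> by apply: groupJ; [apply: mem_gen|apply: longest_in].
have Sw : s ^ longest J \in S.
  by rewrite -(len_eq1 hS) longest_conj_len ?mem_gen // (len_eq1 hS) (subsetP sJS).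
by rewrite -(mem_genS sJS Sw).
Qed.

Lemma longest_conj I J : I \subset S -> J \subset I ->
  longest (J :^ longest I) = longest J ^ longest I.
Proof.
move=> sIS sJI; have sJS := subset_trans sJI sIS.
have sJwI : J :^ longest I \subset I by rewrite -{2}(conj_longest sIS) conjSg.
have sJwS := subset_trans sJwI sIS.
have JI y : y \in <<J>> -> y \in <<I>> by apply/subsetP/genS.
symmetry; apply: longest_unique => //.
  by rewrite genJ memJ_conjg longest_in.
move=> _ /imsetP[s Js ->]; have Ss := subsetP sJS s Js.
have Sw : s ^ longest I \in S by apply: (subsetP sJwS); rewrite memJ_conjg.
rewrite inverts_lenS // -conjMg !longest_conj_len ?groupM ?JI ?longest_in ?mem_gen //.
by rewrite -inverts_lenS // longest_descent.
Qed.

End Parabolic.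

(** * Bruhat order and double cosets *)

Section DoubleCosets.

Context {gT : finGroupType} (S : {set gT}) (hS : coxeter_system S).
Implicit Types (a b : seq gT) (r s t v w x y z : gT) (I J L : {set gT}) (p : dcoset (gT := gT)).
Local Notation len := (len S).
Local Notation inverts := (inverts S).
Local Notation reflection := (reflection S).
Local Notation longest := (longest S).
Local Notation bruhat := (bruhat S).
Local Notation bruhat_step := (bruhat_step S).

Lemma bruhat_stepP x y :
  reflect (exists r, [/\ reflection r, y = x * r & len x < len y]) (bruhat_step x y).
Proof.
apply: (iffP exists_inP) => [[r Rr /andP[/eqP e lt_xy]]|[r [Rr e lt_xy]]]; exists r => //.
by rewrite e eqxx -e lt_xy.
Qed.

Lemma bruhat_lt_len x y : bruhat x y -> x = y \/ len x < len y.
Proof.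
case/connectP=> a; elim: a x => [|z a IHa] x /= => [_ ->|/andP[xz /IHa H] /H]; first by left.
case/bruhat_stepP: xz => r [_ _ lt_xz] [<-|lt_zy]; right => //.
exact: ltn_trans lt_xz lt_zy.
Qed.

Lemma bruhat_anti x y : bruhat x y -> bruhat y x -> x = y.
Proof.
case/bruhat_lt_len=> // lt_xy /bruhat_lt_len[//|].
by rewrite ltnNge ltnW.
Qed.

(* The lifting property: a covering [y -> y * r] with [r != s] induces
   [y * s -> y * s * r ^ s]. *)
Lemma bruhat_lift y z s : s \in S -> bruhat y z -> inverts z s -> bruhat (y * s) z.
Proof.
move=> Ss /connectP[a ya ez] zs; rewrite {}ez in zs *.
elim: a y ya zs => [|y1 a IHa] y /=.
  rewrite (inverts_lenS hS) // => _ lt_ys; apply: connect1; apply/bruhat_stepP.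
  by exists s; rewrite -mulgA (S_square hS) // mulg1 reflectionS.
case/andP=> /bruhat_stepP[r [Rr -> lt_y]] ya zs.
have [ers|neq_rs] := eqVneq r s; first by rewrite -ers; apply/connectP; exists a.
apply: connect_trans (IHa _ ya zs); apply: connect1; apply/bruhat_stepP.
have yr : ~~ inverts y r by rewrite (inverts_len hS) // -leqNgt ltnW.
have Rrs : reflection (r ^ s) by rewrite reflectionJ.
exists (r ^ s); split=> //; first by rewrite conjgE !mulgA mulgK.
have e : y * r * s = y * s * r ^ s by rewrite conjgE !mulgA mulgK.
rewrite e ltn_neqAle eq_sym (len_reflection_neq hS) //= leqNgt -(inverts_len hS) //.
rewrite (invertsM hS) conjgK (negbTE yr) addbF (invertsS hS) //.
by rewrite -(inj_eq (conjg_inj s^-1)) conjgK [s ^ _]conjgE invgK mulgV mulg1.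
Qed.

Lemma bruhatV x y : bruhat x y -> bruhat x^-1 y^-1.
Proof.
case/connectP=> a; elim: a x => [|z a IHa] x /= => [_ ->|/andP[xz /IHa H] /H].
  exact: connect0.
apply: connect_trans; apply: connect1; apply/bruhat_stepP.
case/bruhat_stepP: xz => r [Rr ez lt_xz]; exists (r ^ x^-1).
split; rewrite ?reflectionJ ?(lenV hS) //.
rewrite ez conjgE invgK mulKg invMg; congr (_ * _); apply/eqP.
by rewrite eq_invg_mul (reflection_square hS).
Qed.

Lemma bruhat_liftl y z s : s \in S -> bruhat y z -> inverts z^-1 s -> bruhat (s * y) z.
Proof.
move=> Ss yz zs; rewrite -[s * y]invgK -[z]invgK invMg (S_inv hS Ss); apply: bruhatV.
exact: bruhat_lift (bruhatV yz) zs.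
Qed.

(** Starting from [z], multiply by one letter at a time on either side; the lifting property keeps
    the result below [z]. *)
Lemma bruhat_double_coset I J z y : I \subset S -> J \subset S ->
    {in I, forall s, inverts z^-1 s} -> {in J, forall s, inverts z s} ->
  y \in <<I>> * [set z] * <<J>> -> bruhat y z.
Proof.
move=> sIS sJS zI zJ /mulsgP[_ b /mulsgP[a _ Ia /set1P-> ->] Jb ->].
have [c Ic <-] := gen_word Ia; have {b Jb}[b + <-] := gen_word Jb.
elim: c Ic => [_|s c IHc /= /andP[Is Ic] Jb]; last first.
  rewrite big_cons -!mulgA; apply: bruhat_liftl; rewrite ?zI ?(subsetP sIS) //.
  by rewrite mulgA; apply: IHc.
rewrite big_nil mul1g; elim/last_ind: b => [|b s IHb].
  by rewrite big_nil mulg1 => _; apply: connect0.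
rewrite all_rcons prod_rcons mulgA => /andP[Js Jb].
by apply: bruhat_lift; rewrite ?zJ ?(subsetP sJS) ?IHb.
Qed.

Lemma bruhat_max_double_coset I J z (D : {set gT}) : I \subset S -> J \subset S ->
    {in I, forall s, inverts z^-1 s} -> {in J, forall s, inverts z s} ->
    D = <<I>> * [set z] * <<J>> ->
  bruhat_max S D = z.
Proof.
move=> sIS sJS zI zJ ->; set D' := _ * _.
have zD : z \in D'.
  by rewrite -[z]mul1g -[X in X \in _]mulg1 !mem_mulg ?group1 ?set11.
have zmax y : y \in D' -> bruhat y z by apply: bruhat_double_coset.
rewrite /bruhat_max; case: pickP => [x /andP[xD /forall_inP xmax]|/(_ z)] /=.
  exact: bruhat_anti (zmax x xD) (xmax z zD).
(* The default value in [bruhat_max] is never reached, because [z] itself qualifies. *)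
by rewrite zD => /negP[]; apply/forall_inP.
Qed.

Lemma reduced_word_parab J y : J \subset S -> y \in <<J>> -> all [in J] (reduced_word S y).
Proof.
move=> sJS Jy; have [Sa sa ea] := reduced_wordP hS y.
by apply: (parab_reduced_word hS) => //; rewrite ea.
Qed.

(** Each monoid step multiplies by a letter of [J] or does nothing. Hence in an up step the star
    product need not be computed: its double coset is that of [x]. *)
Lemma star_coset J x y : J \subset S -> y \in <<J>> ->
  exists2 v, v \in <<J>> & star S x y = x * v.
Proof.
move=> sJS /(reduced_word_parab sJS); rewrite /star; elim: (reduced_word S y) x => [|s a IHa] x /=.
  by exists 1; rewrite ?mulg1.
case/andP=> Js Ja; have [v Jv ->] := IHa (star_gen S x s) Ja.
rewrite /star_gen; case: ifP => _; last by exists v.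
by exists (s * v); rewrite ?mulgA // groupM // mem_gen.
Qed.

Lemma star_right_max J x y : J \subset S -> {in J, forall s, inverts x s} ->
  y \in <<J>> -> star S x y = x.
Proof.
move=> sJS xJ /(reduced_word_parab sJS); rewrite /star.
elim: (reduced_word S y) => [|s a IHa] //= /andP[Js Ja].
rewrite /star_gen ifN ?IHa // -leqNgt ltnW //.
by rewrite -(inverts_lenS hS) ?xJ // (subsetP sJS).
Qed.

Lemma bruhat_max_up I J : I \subset J -> J \subset S ->
  bruhat_max S (dset (coset_of_elt I 1 J)) = longest J.
Proof.
move=> sIJ sJS; have sIS := subset_trans sIJ sJS.
apply: (@bruhat_max_double_coset I J) => //.
- by move=> s /(subsetP sIJ) Js; rewrite (longestV hS) // (longest_descent hS).
- by move=> s Js; rewrite (longest_descent hS).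
by rewrite /= mulg1 -mulgA lcoset_id ?longest_in.
Qed.

Lemma bruhat_max_down I J : J \subset I -> I \subset S ->
  bruhat_max S (dset (coset_of_elt I 1 J)) = longest I.
Proof.
move=> sJI sIS; have sJS := subset_trans sJI sIS.
apply: (@bruhat_max_double_coset I J) => //.
- by move=> s Is; rewrite (longestV hS) // (longest_descent hS).
- by move=> s /(subsetP sJI) Is; rewrite (longest_descent hS).
by rewrite /= mulg1 rcoset_id ?longest_in.
Qed.

Lemma coset_of_elt_mulr I J x v : v \in <<J>> ->
  coset_of_elt I (x * v) J = coset_of_elt I x J.
Proof.
move=> Jv; rewrite /coset_of_elt; congr DCoset.
by rewrite -[LHS]mulgA -[RHS]mulgA -mulg_set1 -(mulgA _ _ <<J>>) lcoset_id.
Qed.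

Lemma dcomp_up I J z p : I \subset J -> J \subset S ->
    bruhat_max S (dset p) = z ->
  dcomp S p (coset_of_elt I 1 J) = coset_of_elt (dleft p) z J.
Proof.
move=> sIJ sJS pz; rewrite /dcomp pz bruhat_max_up //.
have [v Jv ->] := star_coset z sJS (longest_in S J).
exact: coset_of_elt_mulr.
Qed.

Lemma dcomp_down I J z p : J \subset I -> I \subset S ->
    bruhat_max S (dset p) = z -> {in I, forall s, inverts z s} ->
  dcomp S p (coset_of_elt I 1 J) = coset_of_elt (dleft p) z J.
Proof.
move=> sJI sIS pz zI; rewrite /dcomp pz bruhat_max_down //.
by rewrite (star_right_max _ zI) ?longest_in.
Qed.

End DoubleCosets.

(** * Rotation sequences *)

Section LongestElement.

Context {gT : finGroupType} (S : {set gT}) (hS : coxeter_system S).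
Implicit Types (x y : gT) (I : {set gT}).
Local Notation w := (longest S S).

Lemma longest_square I : I \subset S -> longest S I * longest S I = 1.
Proof. by move=> sIS; rewrite -{1}(longestV hS sIS) mulVg. Qed.

Lemma len_longestl x : len S (w * x) + len S x = len S w.
Proof. by rewrite (len_longest_mul hS) // gen_S. Qed.

Lemma len_longestr x : len S (x * w) + len S x = len S w.
Proof. by rewrite -(lenV hS (x * w)) -(lenV hS x) invMg (longestV hS) // len_longestl. Qed.

Lemma len_mul_longest I x : I \subset S -> x \in <<I>> ->
  len S (x * longest S I) + len S x = len S (longest S I).
Proof.
move=> sIS Ix; rewrite -(len_longest_mul hS sIS (groupVr Ix)) (lenV hS x).
by rewrite -(lenV hS (x * _)) invMg (longestV hS).
Qed.

Lemma longestP x : {in S, forall s, inverts S x s} -> x = w.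
Proof. by apply: (longest_unique hS) => //; apply: gen_S. Qed.

Lemma barE x : bar S x = x ^ w.
Proof. by rewrite /bar conjgE (longestV hS) // mulgA. Qed.

Lemma barK : involutive (bar S).
Proof. by move=> x; rewrite !barE -conjgM longest_square // conjg1. Qed.

Lemma bar_in x : (bar S x \in S) = (x \in S).
Proof. by have := memJ_conjg S w x; rewrite (conj_longest hS) // barE. Qed.

End LongestElement.

Section Rotation.

Context {gT : finGroupType} (S : {set gT}) (hS : coxeter_system S).
Local Notation len := (len S).
Local Notation inverts := (inverts S).
Local Notation longest := (longest S).

Section Definitions.

Variables x y : gT.

(* Shifted by one from the text: [rot_seq (bar t) s n] is [u_(n-1)]. *)
Definition rot_seq n : gT := (iter n (rot_next S) (x, y)).1.
Local Notation u := rot_seq.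

Definition ridge n : {set gT} := S :\: [set u n; u n.+1].
Definition facet n : {set gT} := S :\ u n.+1.

(* [gallery n] and [gallery_max n] are x_n and z_n of the file header. *)
Fixpoint gallery n : gT :=
  if n is k.+1 then gallery k * longest (ridge k) * longest (facet k) else 1.

Definition gallery_max n : gT := gallery n * longest (facet n).

Definition gallery_reduced n : bool :=
  len (gallery_max n) == len (gallery n) + len (longest (facet n)).

End Definitions.

Lemma iter_rot_next x y n :
  iter n (rot_next S) (x, y) = (rot_seq x y n, rot_seq x y n.+1).
Proof. by rewrite [LHS]surjective_pairing. Qed.

Lemma ridge_sub x y n : ridge x y n \subset S. Proof. exact: subsetDl. Qed.
Lemma facet_sub x y n : facet x y n \subset S. Proof. exact: subsetDl. Qed.
Hint Resolve ridge_sub facet_sub : core.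

Lemma rot_seqSS x y n :
  rot_seq x y n.+2 = rot_seq x y n ^ longest (facet x y n).
Proof.
have := congr1 snd (iter_rot_next x y n.+1); rewrite iterS iter_rot_next /= => <-.
by rewrite conjgE (longestV hS) // mulgA.
Qed.

Section Sequence.

Context (x y : gT) (Sx : x \in S) (Sy : y \in S) (neq_xy : x != y).
Local Notation u := (rot_seq x y).
Local Notation E := (ridge x y).
Local Notation F := (facet x y).
Local Notation a n := (longest (F n)).
Local Notation b n := (longest (E n)).
Local Notation g := (gallery x y).
Local Notation z := (gallery_max x y).
Local Notation reduced := (gallery_reduced x y).

(** Conjugation by [a n] permutes [F n], which omits [u n.+1], so the image [u n.+2] of [u n] is
    again simple and differs from [u n.+1]. *)
Lemma rot_seq_in_neq n : [/\ u n \in S, u n.+1 \in S & u n != u n.+1].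
Proof.
elim: n => [|n [Sn Sn1 neq_n]] //.
have Fu : u n.+2 \in F n.
  have := memJ_conjg (F n) (a n) (u n).
  by rewrite (conj_longest hS) // -rot_seqSS => ->; rewrite !inE neq_n.
split=> //; first exact: subsetP Fu.
by move: Fu; rewrite !inE eq_sym => /andP[].
Qed.

Lemma rot_seq_in n : u n \in S. Proof. by case: (rot_seq_in_neq n). Qed.

Lemma rot_seq_neq n : u n != u n.+1. Proof. by case: (rot_seq_in_neq n). Qed.

Lemma facetE n : F n = u n |: E n.
Proof.
apply/setP=> v; rewrite !inE negb_or; have [->|//] := eqVneq v (u n).
by rewrite rot_seq_neq rot_seq_in.
Qed.

Lemma ridge_eq n : E n = F n :\ u n.
Proof. by apply/setP=> v; rewrite !inE negb_or andbA. Qed.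

Lemma ridgeS n : E n.+1 = F n :\ u n.+2.
Proof. by apply/setP=> v; rewrite !inE negb_or andbA [X in X && _]andbC. Qed.

Lemma sub_ridge_facet n : E n \subset F n.
Proof. by rewrite ridge_eq subsetDl. Qed.

Lemma sub_ridgeS_facet n : E n.+1 \subset F n.
Proof. by rewrite ridgeS subsetDl. Qed.

Lemma ridge_conj n : E n.+1 = E n :^ a n.
Proof.
by rewrite ridgeS ridge_eq conjDg conj_longest // conjg_set1 -rot_seqSS.
Qed.

Lemma longest_ridgeS n : b n.+1 = b n ^ a n.
Proof. by rewrite ridge_conj (longest_conj hS) // sub_ridge_facet. Qed.

Lemma len_longest_ridge n : len (b n) = len (b 0).
Proof.
elim: n => // n <-; rewrite longest_ridgeS (longest_conj_len hS) //.
exact: subsetP (genS (sub_ridge_facet n)) _ (longest_in S _).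
Qed.

(** The relation [b n.+1 = b n ^ a n] telescopes along the gallery. It gives [z n] a factorization
    starting with [b 0], from which left descents can be read. *)
Lemma gallery_ridge n : g n * b n = b 0 * g n.
Proof.
elim: n => [|n IHn]; first by rewrite mul1g mulg1.
by rewrite /= longest_ridgeS conjgE !mulgA mulgK -{}IHn.
Qed.

Lemma gallery_maxE n : z n = g n.+1 * b n.+1.
Proof.
by rewrite /= longest_ridgeS conjgE !mulgA mulgK -(mulgA (g n)) longest_square ?mulg1.
Qed.

Lemma gallery_max_ridge n : z n = b 0 * g n.+1.
Proof. by rewrite gallery_maxE gallery_ridge. Qed.

Lemma gallerySE n : g n.+1 = z n * b n.+1.
Proof. by rewrite gallery_maxE -mulgA longest_square ?mulg1. Qed.

Lemma gallery_maxS n : z n.+1 = z n * (b n.+1 * a n.+1).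
Proof. by rewrite mulgA -gallerySE. Qed.

Lemma gallery_reduced0 : reduced 0.
Proof. by rewrite /gallery_reduced /gallery_max /= mul1g len1. Qed.

Lemma gallery_max_right n : reduced n -> {in F n, forall s, inverts (z n) s}.
Proof.
move=> /eqP red s Fs; have Ss := subsetP (facet_sub x y n) s Fs.
rewrite (inverts_lenS hS) // red -mulgA; apply: leq_ltn_trans (lenM hS _ _) _.
by rewrite ltn_add2l -(inverts_lenS hS) // (longest_descent hS).
Qed.

Lemma longest_ridgeS_in n : b n.+1 \in <<F n>>.
Proof. exact: subsetP (genS (sub_ridgeS_facet n)) _ (longest_in S _). Qed.

Lemma len_galleryS n : reduced n -> len (g n.+1) + len (b n.+1) = len (z n).
Proof.
move=> red; rewrite gallerySE (len_right_max hS (facet_sub x y n)) //.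
  exact: gallery_max_right.
exact: longest_ridgeS_in.
Qed.

(** The factorization [z n = b 0 * g n.+1] is length-additive, because [b 0] and [b n.+1] have equal
    length. *)
Lemma gallery_max_left n : reduced n -> {in E 0, forall s, inverts (z n)^-1 s}.
Proof.
move=> red s Es; have Ss := subsetP (ridge_sub x y 0) s Es.
rewrite (inverts_lenV hS) // -(len_galleryS red) gallery_max_ridge mulgA addnC.
apply: leq_ltn_trans (lenM hS _ _) _; rewrite ltn_add2r len_longest_ridge.
rewrite -(inverts_lenV hS) // (longestV hS) //; exact: (longest_descent hS).
Qed.

(** Right multiplication of [z n] by elements of [<<F n>>] subtracts lengths. As [b n.+1 * s] is
    shorter than [b n.+1], it leaves a longer element. *)
Lemma galleryS_ridge n : reduced n -> {in E n.+1, forall s, ~~ inverts (g n.+1) s}.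
Proof.
move=> red s Es; have Ss := subsetP (ridge_sub x y n.+1) s Es.
have Fs : s \in F n by apply: (subsetP (sub_ridgeS_facet n)).
have Fbs : b n.+1 * s \in <<F n>> by rewrite groupM ?longest_ridgeS_in ?mem_gen.
have e1 := len_right_max hS (facet_sub x y n) (gallery_max_right red) Fbs.
rewrite mulgA -gallerySE in e1.
have e2 := len_galleryS red.
have := longest_descent hS (ridge_sub x y n.+1) Es.
rewrite !(inverts_lenS hS) // -leqNgt.
move: e1 e2.
set n1 := len (g n.+1 * s); set n2 := len (b n.+1 * s).
lia.
Qed.

(* A descent of [g n.+1] in [F n.+1] must be [u n.+1], and it is also one of
   [z n = b 0 * g n.+1], whose other descents are known to exhaust [F n]. *)
Lemma gallery_stop n : reduced n -> ~~ reduced n.+1 -> z n = longest S.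
Proof.
move=> red; case: (boolP [exists s in F n.+1, inverts (g n.+1) s]); last first.
  rewrite negb_exists_in => /forall_inP noF /negP[]; apply/eqP.
  exact: (len_right_min hS (facet_sub x y n.+1)) noF (longest_in S _).
case/exists_inP=> s Fs gs _; have Ss := subsetP (facet_sub x y n.+1) s Fs.
have es : s = u n.+1.
  move: Fs; rewrite facetE => /setU1P[//|Es].
  by have := galleryS_ridge red Es; rewrite gs.
apply: longestP => // v Sv; have [ev|nev] := eqVneq v (u n.+1); last first.
  by apply: gallery_max_right => //; rewrite !inE nev.
rewrite (inverts_lenS hS) // -(len_galleryS red) {1}gallery_max_ridge addnC -mulgA.
apply: leq_ltn_trans (lenM hS _ _) _.
by rewrite !len_longest_ridge ltn_add2l -(inverts_lenS hS) // ev -es.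
Qed.

(** Equality would make [u n] a descent of [b n], although [u n] lies outside [E n]. *)
Lemma len_longest_ridge_facet n : len (b n) < len (a n).
Proof.
have Fu : u n \in F n by rewrite facetE setU11.
have Fb : b n \in <<F n>>.
  exact: subsetP (genS (sub_ridge_facet n)) _ (longest_in S _).
rewrite ltn_neqAle longest_max // andbT; apply/negP=> /eqP eb.
have : inverts (b n) (u n).
  apply: (longest_inverts hS _ Fb); first by rewrite eb.
    exact: mem_gen.
  exact: reflectionS (rot_seq_in _).
move/(inverts_parab hS (ridge_sub x y n) (longest_in S _)).
by rewrite (mem_genS hS) // ?rot_seq_in // ridge_eq !inE eqxx.
Qed.

(** Once [z n] is the longest element, further multiplication complements lengths. Additivity at
    [n.+1] would then force [a n.+1] to be no longer than [b n.+1]. *)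
Lemma gallery_full n : z n = longest S -> ~~ reduced n.+1.
Proof.
move=> zn; rewrite /gallery_reduced gallery_maxS gallerySE zn.
have := len_longestl hS (b n.+1); have := len_longestl hS (b n.+1 * a n.+1).
have := len_longest_ridge_facet n.+1; lia.
Qed.

Lemma ridge_gallery n : E n = E 0 :^ g n.
Proof.
elim: n => [|n IHn]; first by rewrite conjsg1.
by rewrite ridge_conj /= !conjsgM -IHn (conj_longest hS).
Qed.

Lemma len_gallery_mul n : reduced n -> len (g n.+1) = len (g n) + len (b n * a n).
Proof.
move=> red; have := len_galleryS red; rewrite (eqP red) len_longest_ridge.
have Fb : b n \in <<F n>>.
  exact: subsetP (genS (sub_ridge_facet n)) _ (longest_in S _).
have := len_mul_longest hS (facet_sub x y n) Fb; rewrite len_longest_ridge; lia.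
Qed.

(** At the start, [u 0 * b 0] is longer than [b 0], and multiplication by [a 0] reverses the
    comparison. A left descent then survives length-additive extension on the right. *)
Lemma gallery_left_descent n : (forall j, j <= n -> reduced j) ->
  len (u 0 * g n.+1) < len (g n.+1).
Proof.
have Fb : b 0 \in <<F 0>>.
  exact: subsetP (genS (sub_ridge_facet 0)) _ (longest_in S _).
have Fu : u 0 \in F 0 by rewrite facetE setU11.
have Fub : u 0 * b 0 \in <<F 0>> by rewrite groupM // mem_gen.
elim: n => [_|n IHn red].
  have -> : u 0 * g 1 = u 0 * b 0 * a 0 by rewrite /= mul1g mulgA.
  have -> : g 1 = b 0 * a 0 by rewrite /= mul1g.
  have := len_mul_longest hS (facet_sub x y 0) Fb.
  have := len_mul_longest hS (facet_sub x y 0) Fub.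
  suff : len (b 0) < len (u 0 * b 0) by lia.
  have := len_reflection_neq hS (b 0)^-1 (reflectionS Sx).
  rewrite -[len _](lenV hS) invMg invgK (S_inv hS Sx) (lenV hS) ltn_neqAle eq_sym => -> /=.
  rewrite leqNgt -(inverts_lenV hS) // (longestV hS) //; apply/negP.
  move/(inverts_parab hS (ridge_sub x y 0) (longest_in S _)).
  by rewrite (mem_genS hS) // ridge_eq !inE eqxx.
rewrite (len_gallery_mul (red n.+1 (leqnn _))).
have -> : u 0 * g n.+2 = u 0 * g n.+1 * (b n.+1 * a n.+1) by rewrite /= !mulgA.
apply: leq_ltn_trans (lenM hS _ _) _.
by rewrite ltn_add2r IHn // => j /leqW; apply: red.
Qed.

(** * End of the rotation sequence at its depth *)

Section Depth.

Context (d : nat) (red : forall j, j <= d -> reduced j) (stop : ~~ reduced d.+1).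

Lemma depth_full : z d = longest S.
Proof. exact: gallery_stop (red (leqnn d)) stop. Qed.

(** Otherwise the longest element of [S] would lie in [<<F 0>>] and could not have the descent
    [u 1]. *)
Lemma depth_gt0 : 0 < d.
Proof.
have full := depth_full; rewrite lt0n; apply/eqP=> d0; move: full; rewrite d0.
rewrite /gallery_max /= mul1g => ea; have : inverts (a 0) (u 1).
  by rewrite ea (longest_descent hS).
move/(inverts_parab hS (facet_sub x y 0) (longest_in S _)).
by rewrite (mem_genS hS) // !inE eqxx.
Qed.

(** Here [g d] is the longest element of [S] times [a d], so the left descent [x] of [g d] makes
    [bar S x] a left ascent of [a d]. The only simple reflection outside [F d] is [u d.+1]. *)
Lemma rot_seq_depth : u d.+1 = bar S x.
Proof.
have : len (u 0 * g d) < len (g d).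
  have d_gt0 := depth_gt0; rewrite -(prednK d_gt0); apply: gallery_left_descent => j.
  by move=> le_j; apply: red; rewrite (leq_trans le_j) ?leq_pred.
have -> : g d = longest S * a d.
  by rewrite -depth_full /gallery_max -mulgA longest_square ?mulg1.
have -> : u 0 * (longest S * a d) = longest S * (bar S x * a d).
  by rewrite (barE hS) conjgE !mulgA mulgV mul1g.
have := len_longestl hS (a d); have := len_longestl hS (bar S x * a d).
move=> e1 e2 lt_l; have lt_a : len (a d) < len (bar S x * a d) by lia.
have Sbx : bar S x \in S by rewrite (bar_in hS).
apply/eqP; rewrite eq_sym; apply: contraLR lt_a => neq.
rewrite -leqNgt ltnW // -(inverts_lenV hS) // (longestV hS) // (longest_descent hS) //.
by rewrite !inE neq.
Qed.

(** The longest element equals [b 0 * g d.+1] and hence conjugates [E 0] to [E d.+1]. Comparing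
    complements determines the remaining term. *)
Lemma rot_seq_depthS : u d.+2 = bar S y.
Proof.
have : bar S y \notin E d.+1.
  have -> : E d.+1 = E 0 :^ longest S.
    rewrite ridge_gallery -depth_full gallery_max_ridge conjsgM.
    by rewrite (conj_longest hS).
  by rewrite (barE hS) memJ_conjg !inE eqxx orbT.
rewrite !inE (bar_in hS) Sy andbT negbK rot_seq_depth => /orP[|/eqP->//].
by rewrite (inj_eq (inv_inj (barK hS))) eq_sym (negbTE neq_xy).
Qed.

End Depth.

End Sequence.

(** * Reversal of the rotation sequence and its gallery *)

Section Reversal.

Context (x y : gT) (Sx : x \in S) (Sy : y \in S) (neq_xy : x != y).
Local Notation u := (rot_seq x y).
Local Notation E := (ridge x y).
Local Notation F := (facet x y).
Local Notation a n := (longest (F n)).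
Local Notation b n := (longest (E n)).
Local Notation g := (gallery x y).
Local Notation z := (gallery_max x y).
Local Notation reduced := (gallery_reduced x y).
Local Notation w := (longest S).

Context (d : nat) (red : forall j, j <= d -> reduced j) (stop : ~~ reduced d.+1).

Lemma bar_setD (A : {set gT}) : (S :\: A) :^ w = S :\: A :^ w.
Proof. by rewrite conjDg (conj_longest hS). Qed.

(** The recurrence is second-order, so pairs of terms are compared. It runs backwards because
    conjugation by [a n] is an involution, and it is compatible with [bar]. *)
Lemma rot_seq_rev n : n <= d.+2 -> rot_seq y x n = bar S (u (d.+2 - n)).
Proof.
suff H k : k <= d.+1 -> rot_seq y x k = bar S (u (d.+2 - k)) /\
    rot_seq y x k.+1 = bar S (u (d.+1 - k)).
  by case: n => [_|n]; [case: (H 0)|rewrite ltnS subSS => /H[]].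
elim: k => [_|k IHk].
  rewrite !subn0 (rot_seq_depthS Sx Sy neq_xy red stop).
  by rewrite (rot_seq_depth Sx Sy neq_xy red stop) !(barK hS).
rewrite ltnS => le_k; case: IHk => [|e0 e1]; first exact: leqW.
rewrite e1 !subSS; split=> //.
rewrite rot_seqSS /facet e1 e0 !subSn ?leqW // !(barE hS).
rewrite -conjg_set1 -bar_setD -/(F (d - k)) (longest_conj hS) ?facet_sub //.
by rewrite -conjJg rot_seqSS -[(_ ^ a _) ^ a _]conjgM longest_square ?facet_sub // conjg1.
Qed.

Lemma facet_rev n : n <= d -> facet y x n = F (d - n) :^ w.
Proof.
move=> le_n; rewrite /facet rot_seq_rev ?ltnS ?leqW // subSS subSn //.
by rewrite bar_setD conjg_set1 (barE hS).
Qed.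

Lemma ridge_rev n : n <= d.+1 -> ridge y x n = E (d.+1 - n) :^ w.
Proof.
have le_S : n <= d.+1 -> n <= d.+2 by apply: leqW.
move=> le_n; rewrite /ridge !rot_seq_rev ?le_S // subSS subSn //.
by rewrite bar_setD conjUg !conjg_set1 !(barE hS) setUC.
Qed.

(** Moved across [w], the new factors become [b (d.+1 - n)] and [a (d - n)]. They take [z (d - n)]
    to [g (d - n).+1] and then to [z (d - n.+1)], undoing the gallery from its end. *)
Lemma gallery_rev n : n <= d -> gallery y x n = z (d - n) * w.
Proof.
elim: n => [_|n IHn lt_n].
  by rewrite subn0 (depth_full Sx Sy neq_xy red stop) // longest_square.
have [le_n le_n1] : n <= d /\ n <= d.+1 by rewrite ltnW // leqW // ltnW.
rewrite /= IHn // facet_rev // ridge_rev // !(longest_conj hS) ?facet_sub ?ridge_sub //.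
rewrite (subSn le_n) -[d - n]prednK ?subn_gt0 // -subnS.
set i := d - n.+1; have ww := longest_square hS (subxx S).
have wwK v : v * w * w = v by rewrite -mulgA ww mulg1.
rewrite !conjgE (longestV hS) // !mulgA !wwK -gallerySE [z i]gallery_maxE.
have -> : g i.+2 = g i.+1 * b i.+1 * a i.+1 by [].
by rewrite -(mulgA _ (a _) (a _)) longest_square ?facet_sub // mulg1.
Qed.

Lemma gallery_max_rev n : n <= d -> gallery_max y x n = g (d - n) * w.
Proof.
move=> le_n; have ww := longest_square hS (subxx S).
rewrite /gallery_max gallery_rev // facet_rev // (longest_conj hS) ?facet_sub //.
rewrite conjgE (longestV hS) // !mulgA -(mulgA _ w w) ww mulg1.
by rewrite -(mulgA _ (a _) (a _)) longest_square ?facet_sub // mulg1.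
Qed.

(** Multiplication by [w] complements lengths and exchanges the roles of [g] and [z], so the length
    difference to be checked is the old one. *)
Lemma gallery_reduced_rev n : n <= d -> gallery_reduced y x n.
Proof.
move=> le_n; rewrite /gallery_reduced gallery_max_rev // gallery_rev // facet_rev //.
rewrite (longest_conj hS) ?facet_sub // (longest_conj_len hS) ?gen_S //.
have := len_longestr hS (z (d - n)); have := len_longestr hS (g (d - n)).
have /eqP := red (leq_subr n d); lia.
Qed.

Lemma gallery_stop_rev : ~~ gallery_reduced y x d.+1.
Proof.
apply: gallery_full; rewrite ?gallery_max_rev // 1?eq_sym //.
by rewrite subnn mul1g.
Qed.

End Reversal.

End Rotation.

(** * Expressions *)

Section Expressions.

Context {gT : finGroupType} (S : {set gT}).
Implicit Types (I J : {set gT}) (e : seq {set gT}) (c : seq (step (gT := gT))).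

Lemma expressed_from_rcons p I e J :
  expressed_from S p I (rcons e J) =
  dcomp S (expressed_from S p I e) (coset_of_elt (last I e) 1 J).
Proof. by elim: e p I => //= I' e IHe p I; rewrite IHe. Qed.

Lemma expressed_mkseq (f : nat -> {set gT}) m :
  expressed S (mkseq f m.+3) =
  dcomp S (expressed S (mkseq f m.+2)) (coset_of_elt (f m.+1) 1 (f m.+2)).
Proof.
rewrite mkseqS [mkseq f m.+2]/mkseq /= expressed_from_rcons; congr dcomp.
have last_iota n k : last n (iota n.+1 k) = (n + k)%N.
  by elim: k n => [|k IHk] n; rewrite ?addn0 //= IHk addSnnS.
by rewrite (last_map f _ 1%N) last_iota.

Qed.

Fixpoint valid_steps I c : bool :=
  match c with
  | [::] => true
  | Add x :: c' => [&& x \in S, x \notin I & valid_steps (x |: I) c']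
  | Rem x :: c' => (x \in I) && valid_steps (I :\ x) c'
  end.

Lemma expr_is_expression I c : I \subset S -> valid_steps I c -> is_expression S (expr I c).
Proof.
move=> sIS vc; suff: all (fun J : {set gT} => J \subset S) (expr I c) &&
    path (adjacent S) I (scanl do_step I c) by [].
elim: c I sIS vc => [|[] x c IHc] I sIS /=; first by rewrite sIS.
  case/and3P=> Sx nIx /IHc; rewrite subUset sub1set Sx => /(_ sIS) /= /andP[/andP[_ ->] ->].
  by rewrite sIS !andbT; apply/exists_inP; exists x; rewrite ?nIx ?eqxx.
case/andP=> Ix /IHc; rewrite (subset_trans (subsetDl _ _) sIS) => /(_ isT) /= /andP[/andP[_ ->] ->].
rewrite sIS !andbT; apply/exists_inP; exists x; first exact: (subsetP sIS).
by rewrite Ix eqxx orbT.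
Qed.

End Expressions.

(** * Double cosets expressed by rotation expressions *)

Section RotationExpressions.

Context {gT : finGroupType} (S : {set gT}) (hS : coxeter_system S).
Context (x y : gT) (Sx : x \in S) (Sy : y \in S) (neq_xy : x != y).
Local Notation len := (len S).
Local Notation inverts := (inverts S).
Local Notation longest := (longest S).
Local Notation u := (rot_seq S x y).
Local Notation E := (ridge S x y).
Local Notation F := (facet S x y).
Local Notation a n := (longest (F n)).
Local Notation b n := (longest (E n)).
Local Notation g := (gallery S x y).
Local Notation z := (gallery_max S x y).
Local Notation reduced := (gallery_reduced S x y).

(** Interleaving gives [E 0, F 0, E 1, F 1, ...]. A rotation expression and the right side of a
    switchback are both intervals of this one sequence. *)
Definition face i : {set gT} := if odd i then F i./2 else E i./2.

Lemma face_double n : face n.*2 = E n.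
Proof. by rewrite /face odd_double doubleK. Qed.

Lemma face_doubleS n : face n.*2.+1 = F n.
Proof. by rewrite /face /= odd_double uphalf_double. Qed.

Lemma expr_faces m n :
  expr (E m) (flatten [seq [:: Add (u i); Rem (u i.+2)] | i <- iota m n])
  = [seq face i | i <- iota m.*2 n.*2.+1].
Proof.
elim: n m => [|n IHn] m; first by rewrite /= face_double.
rewrite doubleS [iota m.*2 _]/= [in RHS]map_cons [in RHS]map_cons.
rewrite face_double face_doubleS -doubleS -IHn /expr /=.
by rewrite -facetE // -ridgeS.
Qed.

Lemma expr_faces_odd m n :
  expr (F m) (flatten [seq [:: Rem (u i.+1); Add (u i)] | i <- iota m.+1 n])
  = [seq face i | i <- iota m.*2.+1 n.*2.+1].
Proof.
elim: n m => [|n IHn] m; first by rewrite /= face_doubleS.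
rewrite doubleS [iota m.*2.+1 _]/= [in RHS]map_cons [in RHS]map_cons.
rewrite face_doubleS -doubleS face_double -IHn /expr /=.
by rewrite -ridgeS -facetE.
Qed.

Lemma valid_faces m n :
  valid_steps S (E m) (flatten [seq [:: Add (u i); Rem (u i.+2)] | i <- iota m n]).
Proof.
elim: n m => [|n IHn] m //=; rewrite -facetE // -ridgeS IHn andbT.
rewrite rot_seq_in //= !inE eqxx /= rot_seq_in // andbT.
by rewrite eq_sym rot_seq_neq.
Qed.

Lemma faces_is_expression n : is_expression S (mkseq face n.*2.+3).
Proof.
rewrite /mkseq -[0]/(0.*2) -(expr_faces 0 n.+1).
by apply: expr_is_expression; [apply: ridge_sub|apply: valid_faces].
Qed.

Lemma bruhat_max_gallery n (J : {set gT}) : reduced n -> J \subset F n ->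
  bruhat_max S (dset (coset_of_elt (E 0) (z n) J)) = z n.
Proof.
move=> red sJF; apply: (bruhat_max_double_coset hS (ridge_sub S x y 0) (J := J)) => //.
- exact: subset_trans sJF (facet_sub S x y n).
- exact: gallery_max_left.
- by move=> s /(subsetP sJF); apply: gallery_max_right.
Qed.

(** An up step may replace [z n] by [z n.+1], as they differ by an element of [<<F n.+1>>]; a down
    step keeps [z n]. Reducedness ensures that these elements are Bruhat-maximal. *)
Lemma expressed_faces n : (forall j, j <= n -> reduced j) ->
  expressed S (mkseq face n.*2.+2) = coset_of_elt (E 0) (z n) (F n) /\
  expressed S (mkseq face n.*2.+3) = coset_of_elt (E 0) (z n) (E n.+1).
Proof.
have odd_step k : reduced k ->
    expressed S (mkseq face k.*2.+2) = coset_of_elt (E 0) (z k) (F k) ->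
  expressed S (mkseq face k.*2.+3) = coset_of_elt (E 0) (z k) (E k.+1).
  move=> red e; rewrite expressed_mkseq e face_doubleS -doubleS face_double.
  apply: (dcomp_down hS (z := z k)); rewrite ?sub_ridgeS_facet ?facet_sub //.
    exact: bruhat_max_gallery.
  exact: gallery_max_right.
elim: n => [|n IHn] red.
  suff e : expressed S (mkseq face 2) = coset_of_elt (E 0) (z 0) (F 0).
    by split=> //; apply: odd_step => //; apply: red.
  have -> : z 0 = 1 * a 0 by [].
  by rewrite coset_of_elt_mulr ?longest_in // /expressed /= -(face_double 0) -(face_doubleS 0).
have [|_ e1] := IHn; first by move=> j /leqW; apply: red.
suff e : expressed S (mkseq face n.+1.*2.+2) = coset_of_elt (E 0) (z n.+1) (F n.+1).
  by split=> //; apply: odd_step => //; apply: red.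
rewrite doubleS expressed_mkseq e1 -doubleS face_double face_doubleS.
rewrite (dcomp_up hS (z := z n)) ?sub_ridge_facet ?facet_sub //=; last first.
  by rewrite bruhat_max_gallery ?sub_ridgeS_facet // red.
rewrite gallery_maxS // coset_of_elt_mulr // groupM ?longest_in //.
exact: subsetP (genS (sub_ridge_facet _ _ _ _)) _ (longest_in S _).
Qed.

Lemma dcomp_reduced_down n : reduced n ->
  dcomp_reduced S (coset_of_elt (E 0) (z n) (F n)) (coset_of_elt (F n) 1 (E n.+1)).
Proof.
move=> red; rewrite /dcomp_reduced bruhat_max_gallery //.
rewrite bruhat_max_down ?sub_ridgeS_facet ?facet_sub //=.
by rewrite mulgKV (eqP red) /gallery_max mulgK.
Qed.

(** Removing [b n.+1] from [z n] leaves [g n.+1], so the composition condition is literally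
    additivity at [n.+1]. Down steps impose no new condition. *)
Lemma dcomp_reduced_up n : reduced n ->
  dcomp_reduced S (coset_of_elt (E 0) (z n) (E n.+1)) (coset_of_elt (E n.+1) 1 (F n.+1))
  <-> reduced n.+1.
Proof.
move=> red; rewrite /dcomp_reduced bruhat_max_gallery ?sub_ridgeS_facet //.
rewrite bruhat_max_up ?sub_ridge_facet ?facet_sub //=.
rewrite longestV ?ridge_sub // -gallerySE //.
by split=> [/eqP|/eqP].
Qed.

Lemma reduced_faces k :
  reduced_expression S (mkseq face k.*2.+3) <-> forall j, j <= k -> reduced j.
Proof.
have takeE i : i < k.*2.+3 -> take i.+1 (mkseq face k.*2.+3) = mkseq face i.+1.
  by move=> lt_i; rewrite /mkseq -map_take take_iota (minn_idPl lt_i).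
rewrite /reduced_expression size_mkseq; split=> [[_ redE]|red].
  (* The coset at stage [j] is computable only once all stages up to [j] are reduced, so reducedness
     is extracted one up step at a time. *)
  suff H j : j <= k -> forall i, i <= j -> reduced i by move=> j /H; apply.
  elim: j => [_ i|j IHj lt_jk i]; first by rewrite leqn0 => /eqP->; apply: gallery_reduced0.
  rewrite leq_eqVlt => /predU1P[->|]; last exact: IHj (ltnW lt_jk) i.
  have redj := IHj (ltnW lt_jk).
  have lt3 : j.*2.+3 < k.*2.+3 by lia.
  have := redE j.*2.+2 isT lt3; rewrite takeE ?(ltnW lt3) //.
  rewrite !nth_mkseq ?(ltnW lt3) // -doubleS face_double face_doubleS doubleS.
  by have [_ ->] := expressed_faces redj; rewrite dcomp_reduced_up // redj.
split; first exact: faces_is_expression.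
case=> // i _ lt_i; rewrite takeE ?(ltnW lt_i) // !nth_mkseq ?(ltnW lt_i) //.
(* The step leaving [face i.+1] goes down if [i = n.*2] and up if [i = n.*2.+1]. In the second case
   [n < k], so that [red] applies to [n.+1]. *)
have [n [ei le_n]] : exists n, (i = n.*2 \/ i = n.*2.+1 /\ n < k) /\ n <= k.
  exists i./2; have := odd_double_half i; case: (odd i) => /= e; split; lia.
have redn j : j <= n -> reduced j by move=> le_j; apply: red (leq_trans le_j le_n).
have [e1 e2] := expressed_faces redn.
case: ei => [->|[-> lt_n]].
  by rewrite e1 face_doubleS -doubleS face_double; apply: dcomp_reduced_down; apply: redn.
rewrite e2 -doubleS face_double face_doubleS dcomp_reduced_up; [exact: red|exact: redn].
Qed.

Lemma faces_split n :
  mkseq face n.*2.+3 = E 0 :: [seq face i | i <- iota 1 n.*2.+1] ++ [:: E n.+1].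
Proof.
by rewrite mkseqS -[n.*2.+2]doubleS face_double -cats1 -cat_cons.
Qed.

End RotationExpressions.

(** * Depth and switchback relations in terms of galleries *)

Section Switchback.

Context {gT : finGroupType} (S : {set gT}) (hS : coxeter_system S).
Context (s t : gT) (Ss : s \in S) (St : t \in S) (neq_st : t != bar S s).
Local Notation x := (bar S t).
Local Notation u := (rot_seq S x s).

Let Sx : x \in S. Proof. by rewrite (bar_in hS). Qed.

Let neq_xs : x != s.
Proof. by apply: contra_neq neq_st => <-; rewrite (barK hS). Qed.

Lemma rotation_Posz n : rotation S s t (Posz n) = u n.+1.
Proof. by rewrite /rotation iter_rot_next. Qed.

Lemma rotation_pred n : rotation S s t (n%:Z - 1)%R = u n.
Proof.
case: n => [|n] //; rewrite -[n.+1]addn1 PoszD GRing.addrK.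
by rewrite rotation_Posz addn1.
Qed.

Lemma rotation_succ n : rotation S s t (n%:Z + 1)%R = u n.+2.
Proof. by rewrite -PoszD addn1 rotation_Posz. Qed.

Lemma rotation_exprE k : rotation_expr S s t k = mkseq (face S x s) k.*2.+3.
Proof.
rewrite /rotation_expr /mkseq -[0]/(0.*2) -(expr_faces hS Sx Ss neq_xs 0 k.+1) setUC.
congr (expr _ (flatten _)); apply: eq_map => i.
by rewrite rotation_pred rotation_succ.
Qed.

(** Reducedness of rotation expressions is closed under shortening, so the maximal index is the one
    just before the first failure. *)
Lemma rotation_depthP d : rotation_depth S s t d <->
  (forall j, j <= d -> gallery_reduced S x s j) /\ ~~ gallery_reduced S x s d.+1.
Proof.
have redP k : reduced_expression S (rotation_expr S s t k) <->
    forall j, j <= k -> gallery_reduced S x s j.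
  by rewrite rotation_exprE; apply: reduced_faces.
split=> [[/redP red max_d]|[red stop]].
  split=> //; apply/negP=> red1; have := max_d d.+1; rewrite ltnn => H.
  suff: false by []; apply: H; apply/redP=> j.
  by rewrite leq_eqVlt => /predU1P[->//|]; apply: red.
split=> [|k /redP redk]; first exact/redP.
by rewrite leqNgt; apply: contra stop; apply: redk.
Qed.

Lemma switchback_faces d : rotation_depth S s t d ->
  switchback S (expr (S :\ s) [:: Add s; Rem t])
               [seq face S x s i | i <- iota 1 d.*2.+1].
Proof.
move=> depth; rewrite -[1%N]/(0.*2.+1) -(expr_faces_odd hS Sx Ss neq_xs).
have -> : [seq [:: Rem (u i.+1); Add (u i)] | i <- iota 1 d] =
    [seq [:: Rem (rotation S s t (i%:Z)%R); Add (rotation S s t (i%:Z - 1)%R)]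
    | i <- iota 1 d].
  by apply: eq_map => i; rewrite rotation_Posz rotation_pred.
exact: Switchback.
Qed.

(** The two outer ridges are the context; the relation rewrites only the part between them, which
    starts at [S :\ s] and ends at [S :\ t]. *)
Lemma locally_switchback_faces d e : rotation_depth S s t d ->
    e = [:: ridge S x s 0; S :\ s; S; S :\ t; ridge S x s d.+1] ->
    is_expression S e ->
  locally S (switchback S) e (mkseq (face S x s) d.*2.+3).
Proof.
move=> depth -> isE; split=> //; first exact: (faces_is_expression hS Sx Ss neq_xs).
exists [:: ridge S x s 0], [:: ridge S x s d.+1], (expr (S :\ s) [:: Add s; Rem t]),
  [seq face S x s i | i <- iota 1 d.*2.+1]; split.
- exact: switchback_faces depth.
- by rewrite /expr /= (setD1K Ss).
by rewrite faces_split.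
Qed.

End Switchback.

(** * Up-up and down-down relations around [S] *)

Section UpUpDownDown.

Context {gT : finGroupType} (S : {set gT}).
Implicit Types (p q : gT).

Lemma locally_cat (R : seq {set gT} -> seq {set gT} -> Prop) l r a b e f :
    R l r -> e = a ++ l ++ b -> f = a ++ r ++ b ->
  is_expression S e -> is_expression S f -> locally S R e f.
Proof. by move=> Rlr ea fa eE fE; split=> //; exists a, b, l, r. Qed.

Lemma setU1_setD2 p q : p \in S -> p != q -> p |: S :\: [set p; q] = S :\ q.
Proof.
move=> Sp neq_pq; apply/setP=> r; rewrite !inE negb_or.
by have [->|] := eqVneq r p; rewrite ?orFb // Sp neq_pq.
Qed.

Lemma up_up_setD2 p q : p \in S -> q \in S -> p != q ->
  up_up S [:: S :\: [set p; q]; S :\ q; S] [:: S :\: [set p; q]; S :\ p; S].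
Proof.
move=> Sp Sq neq_pq; have eq : q |: S :\: [set p; q] = S :\ p.
  by rewrite (setUC [set p]) setU1_setD2 // eq_sym.
have := @UpUp _ S (S :\: [set p; q]) p q (subsetDl _ _) Sp Sq.
by rewrite /expr /= eq setU1_setD2 // !setD1K // !inE !eqxx orbT; apply.
Qed.

Lemma down_down_setD2 p q : p \in S -> q \in S -> p != q ->
  down_down S [:: S; S :\ p; S :\: [set p; q]] [:: S; S :\ q; S :\: [set p; q]].
Proof.
move=> Sp Sq neq_pq; have := @DownDown _ S S p q (subxx S) Sp Sq neq_pq.
by rewrite /expr /= !setDDl [[set q; p]]setUC.
Qed.

Lemma expr_up_up_down_down p q p' q' : p \in S -> q \in S -> p != q ->
  expr (S :\: [set p; q]) [:: Add p; Add q; Rem p'; Rem q'] =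
  [:: S :\: [set p; q]; S :\ q; S; S :\ p'; S :\: [set p'; q']].
Proof.
move=> Sp Sq neq_pq; rewrite /expr /=.
by rewrite setU1_setD2 // setD1K // setDDl.
Qed.

Lemma up_up_down_down_is_expression p q p' q' :
    p \in S -> q \in S -> p != q -> p' \in S -> q' \in S -> p' != q' ->
  is_expression S (expr (S :\: [set p; q]) [:: Add p; Add q; Rem p'; Rem q']).
Proof.
move=> Sp Sq neq_pq Sp' Sq' neq_pq'.
apply: expr_is_expression; first exact: subsetDl.
rewrite /= !inE !eqxx Sp Sq Sp' Sq'.
by rewrite (eq_sym q p) (negbTE neq_pq) (eq_sym q' p') neq_pq' /=; do 4!case: (_ == _).
Qed.

End UpUpDownDown.

Theorem proposition4p9 (gT : finGroupType) (S : {set gT})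
  (hS : coxeter_system S)
  (s t : gT) (hs : s \in S) (ht : t \in S) (hst : t != bar S s)
  (d : nat) (hd : rotation_depth S s t d) :
  let K := S :\: [set s; bar S t] in
  let u := rotation S s t in
  let v := fun i : int => bar S (u i) in
  let D := (d%:Z)%R in
  let lhs := expr K
    (flatten [seq [:: Add (u (i%:Z - 1)%R); Rem (u (i%:Z + 1)%R)]
             | i <- iota 0 d.+1]) in
  let rhs := expr K
    (flatten [seq [:: Add (v (i%:Z + 1)%R); Rem (v (i%:Z - 1)%R)]
             | i <- rev (iota 0 d.+1)]) in
  let m1 := expr K
    [:: Add (u (-1)%R); Add (u 0%R); Rem (u D); Rem (u (D + 1)%R)] in
  let m1_up := expr K
    [:: Add (u 0%R); Add (u (-1)%R); Rem (u D); Rem (u (D + 1)%R)] in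
  let m1_down := expr K
    [:: Add (u (-1)%R); Add (u 0%R); Rem (u (D + 1)%R); Rem (u D)] in
  let m2 := expr K
    [:: Add (u 0%R); Add (u (-1)%R); Rem (u (D + 1)%R); Rem (u D)] in
  let m2' := expr K
    [:: Add (v (D + 1)%R); Add (v D); Rem (v 0%R); Rem (v (-1)%R)] in
  same_coset S lhs rhs /\
  [/\ locally S (switchback S) m1 lhs,
      locally S (up_up S) m1 m1_up /\ locally S (down_down S) m1_up m2,
      locally S (down_down S) m1 m1_down /\ locally S (up_up S) m1_down m2,
      m2 = m2'
    & locally S (switchback S) m2' rhs].
Proof.
move=> K u v D lhs rhs m1 m1_up m1_down m2 m2'.
set x := bar S t; have Sx : x \in S by rewrite (bar_in hS).
have neq_xs : x != s by apply: contra_neq hst => <-; rewrite (barK hS).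
have [red stop] := (rotation_depthP hS hs ht hst d).1 hd.
have ud1 := rot_seq_depth hS Sx hs neq_xs red stop.
have ud2 := rot_seq_depthS hS Sx hs neq_xs red stop.
have uN1 : u (-1)%R = x by [].
have u0 : u 0%R = s by [].
(* [ud1] and [ud2] use the shifted numbering: [rot_seq] at [d.+1] is the term of index [d], so [u D]
   is [bar S x], which is [t]. *)
have uD : u D = t by rewrite /u /D rotation_Posz ud1 (barK hS).
have uD1 : u (D + 1)%R = bar S s by rewrite /u /D rotation_succ ud2.
have lhsE : lhs = mkseq (face S x s) d.*2.+3 by exact: rotation_exprE.
have neq_xbs : bar S s != bar S x by rewrite (inj_eq (inv_inj (barK hS))) eq_sym.
have Sbs : bar S s \in S by rewrite (bar_in hS).
(* The rotation sequence of [x] and [bar S s] starts from [bar S (bar S s) = s] and [x], so its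
   gallery is that of the swapped pair. *)
have depth' : rotation_depth S x (bar S s) d.
  apply/(rotation_depthP hS) => //; rewrite (barK hS).
  split; first by move=> j; apply: (gallery_reduced_rev hS Sx hs neq_xs red stop).
  exact: (gallery_stop_rev hS Sx hs neq_xs red stop).
have rhsE : rhs = mkseq (face S s x) d.*2.+3.
  have := rotation_exprE hS Sx Sbs neq_xbs d; rewrite (barK hS) => <-.
  rewrite /rotation_expr (barK hS) /rhs /K setUC; congr (expr _ (flatten _)).
  (* The right side runs through [d, ..., 0]; reindexing by [d - i] matches it with the reversed
     rotation sequence. *)
  have -> : rev (iota 0 d.+1) = [seq d - i | i <- iota 0 d.+1].
    apply: (@eq_from_nth _ 0); rewrite size_rev ?size_map // size_iota => i lt_i.
    rewrite nth_rev size_iota // (nth_map 0) ?size_iota // !nth_iota ?add0n ?subSS //.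
    by rewrite ltnS leq_subr.
  rewrite -map_comp; apply/eq_in_map => i; rewrite mem_iota => /andP[_]; rewrite ltnS => le_i.
  have uE := rot_seq_rev hS Sx hs neq_xs red stop.
  rewrite [LHS]/= rotation_pred rotation_succ (barK hS) /v /u rotation_pred rotation_succ.
  rewrite !uE ?ltnS ?leqW //.
  by rewrite subSS subSn ?leqW // subSn.
have xK : bar S x = t by rewrite (barK hS).
have KE : K = S :\: [set x; s] by rewrite /K setUC.
have lastE : ridge S x s d.+1 = S :\: [set t; bar S s] by rewrite /ridge ud1 ud2 (barK hS).
have last'E : ridge S s x d.+1 = S :\: [set bar S s; t].
  by rewrite /ridge !(rot_seq_rev hS Sx hs neq_xs red stop) // subSS subSnn subnn (barK hS).
have isE p q p' q' := @up_up_down_down_is_expression _ S p q p' q'.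
have uuddE p q p' q' := @expr_up_up_down_down _ S p q p' q'.
have e2 : m2 = m2'.
  by rewrite /m2 /m2' /v uN1 u0 uD uD1 (barK hS) xK.
have m1E : m1 = [:: S :\: [set x; s]; S :\ s; S; S :\ t; S :\: [set t; bar S s]].
  by rewrite /m1 uN1 u0 uD uD1 KE uuddE.
have m1uE : m1_up = [:: S :\: [set x; s]; S :\ x; S; S :\ t; S :\: [set t; bar S s]].
  by rewrite /m1_up uN1 u0 uD uD1 /K uuddE // 1?eq_sym // (setUC [set s]).
have m1dE : m1_down = [:: S :\: [set x; s]; S :\ s; S; S :\ bar S s; S :\: [set t; bar S s]].
  by rewrite /m1_down uN1 u0 uD uD1 KE uuddE // (setUC [set bar S s]).
have m2E : m2 = [:: S :\: [set x; s]; S :\ x; S; S :\ bar S s; S :\: [set t; bar S s]].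
  by rewrite /m2 uN1 u0 uD uD1 /K uuddE // 1?eq_sym // (setUC [set s]) (setUC [set bar S s]).
have m1_ex : is_expression S m1 by rewrite /m1 uN1 u0 uD uD1 KE isE.
have m1u_ex : is_expression S m1_up by rewrite /m1_up uN1 u0 uD uD1 isE // eq_sym.
have m1d_ex : is_expression S m1_down by rewrite /m1_down uN1 u0 uD uD1 KE isE // eq_sym.
have m2_ex : is_expression S m2 by rewrite /m2 uN1 u0 uD uD1 isE // eq_sym.
have lhs_ex : is_expression S lhs by rewrite lhsE; apply: (faces_is_expression hS Sx hs neq_xs).
have neq_sx : s != x by rewrite eq_sym.
have rhs_ex : is_expression S rhs by rewrite rhsE; apply: (faces_is_expression hS hs Sx neq_sx).
have uu := up_up_setD2 Sx hs neq_xs.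
have dd := down_down_setD2 ht Sbs hst.
split.
  (* The cosets are computed directly: both have the longest element of [S] as representative,
     between the same two subsets. *)
  split=> //; rewrite lhsE rhsE.
  have [_ ->] := expressed_faces hS red.
  have [|_ ->] := expressed_faces hS (x := s) (y := x) (n := d).
    exact: (gallery_reduced_rev hS Sx hs neq_xs red stop).
  rewrite lastE last'E (depth_full hS Sx hs neq_xs red stop).
  rewrite (gallery_max_rev hS Sx hs neq_xs red stop) // subnn mul1g.
  by rewrite /ridge !(setUC [set s]) (setUC [set bar S s]).
split=> //.
- rewrite lhsE; apply: locally_switchback_faces => //.
  by rewrite m1E lastE.
- split.
    exact: (locally_cat (a := [::]) (b := [:: _; _]) uu) m1E m1uE m1_ex m1u_ex.
  exact: (locally_cat (a := [:: _; _]) (b := [::]) dd) m1uE m2E m1u_ex m2_ex.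
- split.
    exact: (locally_cat (a := [:: _; _]) (b := [::]) dd) m1E m1dE m1_ex m1d_ex.
  exact: (locally_cat (a := [::]) (b := [:: _; _]) uu) m1dE m2E m1d_ex m2_ex.
(* This switchback is taken for [x] and [bar S s]; its left side is the middle [S :\ x], [S],
   [S :\ bar S s] of [m2]. *)
rewrite rhsE -e2; have := @locally_switchback_faces _ S hS x (bar S s) Sx Sbs neq_xbs d m2 depth'.
rewrite (barK hS); apply => //.
by rewrite last'E m2E /ridge (setUC [set s]) (setUC [set bar S s]).
Qed.
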